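(* Two rank-$1$ tensors $\mathcal{P}$ and $\mathcal{Q} \in \mathcal{S}_{\alpha}^{\mathbf{k}}$ can be connected by a minimizing geodesic in $\mathcal{S}_{\alpha}^{\mathbf{k}}$ if and only if $\mathcal{P}$ and $\mathcal{Q}$ have matched $\alpha$-compatible representatives.
   Context: Let $d\ge 1$, let $n_1,\dots,n_d\ge 2$ and $k_1,\dots,k_d\ge1$ be integers, $\mathbf{k}=(k_1,\dots,k_d)$, and $\alpha>0$. $\mathbb{S}^{n-1}\subset\mathbb{R}^n$ is the unit sphere, $\langle\cdot,\cdot\rangle$ the Euclidean inner product, and $\sphericalangle(\mathbf{u},\mathbf{v})=\arccos\langle\mathbf{u},\mathbf{v}\rangle\in[0,\pi]$ for unit vectors. The $\alpha$-warped pre-Segre--Veronese manifold $\mathcal{P}_\alpha^{\mathbf{k}}$ is $\mathbb{R}_{>0}\times\mathbb{S}^{n_1-1}\times\cdots\times\mathbb{S}^{n_d-1}$ with the Riemannian metric $$g_{(\lambda,\mathbf{u}_1,\ldots,\mathbf{u}_d)}\bigl((\dot{x}, \dot{\mathbf{u}}_1, \ldots, \dot{\mathbf{u}}_d),(\dot{y}, \dot{\mathbf{v}}_1, \ldots, \dot{\mathbf{v}}_d)\bigr)=\dot{x} \dot{y} + (\alpha\lambda)^2 \sum_{i=1}^d k_i \langle \dot{\mathbf{u}}_i, \dot{\mathbf{v}}_i \rangle .$$ The $\alpha$-warped Segre--Veronese manifold $\mathcal{S}_\alpha^{\mathbf{k}}$ is the submanifold $\{\lambda\mathbf{u}_1^{\otimes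 k_1}\otimes\cdots\otimes\mathbf{u}_d^{\otimes k_d}\mid\lambda>0,\ \mathbf{u}_i\in\mathbb{S}^{n_i-1}\}$ of $\mathbb{R}^{n_1^{k_1}\times\cdots\times n_d^{k_d}}\setminus\{0\}$, with the metric induced from the ambient metric $\varsigma^\alpha_{\lambda \mathcal{W}}(\dot{x}\,\mathcal{W}+\lambda\dot{\mathcal{V}},\dot{y}\,\mathcal{W}+\lambda\dot{\mathcal{V}}')=\dot{x}\dot{y}+(\alpha\lambda)^2\langle\dot{\mathcal{V}},\dot{\mathcal{V}}'\rangle$, where $\lambda>0$, $\|\mathcal{W}\|=1$, $\dot{\mathcal{V}},\dot{\mathcal{V}}'\perp\mathcal{W}$. The map $\otimes:\mathcal{P}_\alpha^{\mathbf{k}}\to\mathcal{S}_\alpha^{\mathbf{k}}$ is $(\lambda,\mathbf{u}_1,\dots,\mathbf{u}_d)\mapsto\lambda\mathbf{u}_1^{\otimes k_1}\otimes\cdots\otimes\mathbf{u}_d^{\otimes k_d}$; elements of $\otimes^{-1}(\mathcal{P})$ are representatives of $\mathcal{P}$. For $p=(\lambda,\mathbf{u}_1,\dots,\mathbf{u}_d)$, $q=(\mu,\mathbf{v}_1,\dots,\mathbf{v}_d)$ in $\mathcal{P}_\alpha^{\mathbf{k}}$ put $M(p,q)=\sqrt{\sum_{i=1}^d k_i\,\sphericalangle^2(\mathbf{u}_i,\mathbf{v}_i)}$. They are $\alpha$-compatible if $M(p,q)<\pi/\alpha$. Representatives $p^\star\in\otimes^{-1}(\mathcal{P})$, $q^\star\in\otimes^{-1}(\mathcal{Q})$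 are matched if $(p^\star,q^\star)$ minimizes $M(p,q)$ over $p\in\otimes^{-1}(\mathcal{P})$, $q\in\otimes^{-1}(\mathcal{Q})$. A minimizing geodesic between two points of a Riemannian manifold is a piecewise smooth curve in the manifold connecting them whose length equals their intrinsic distance (infimum of lengths of piecewise smooth curves connecting them). *)

(* Defs.v *)
From HB Require Import structures.
From mathcomp Require Import all_boot all_order all_algebra.
From mathcomp Require Import all_classical all_reals all_analysis.
Set Implicit Arguments.
Unset Strict Implicit.
Unset Printing Implicit Defensive.
Import Order.TTheory GRing.Theory Num.Theory.
Import numFieldNormedType.Exports.

Local Open Scope classical_set_scope.
Local Open Scope ring_scope.

Section SegreVeronese.
Variables (R : realType) (d : nat) (n k : 'I_d -> nat).

(* A multi-index picks, for each factor i, one coordinate in 'I_(n i) for each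
   of the k i tensor slots of that factor. *)
Definition tensor_index :=
  {dffun forall i : 'I_d, {ffun 'I_(k i) -> 'I_(n i)}}.

Definition tensor := {ffun tensor_index -> R}.

Definition tensor_dot (A B : tensor) : R := \sum_J A J * B J.

Definition tensor_norm (A : tensor) : R := Num.sqrt (tensor_dot A A).

(* The norm that MathComp-Analysis puts on 'rV[R]_m is the max norm, hence an
   explicit Euclidean inner product. *)
Definition euclidean_dot m (u v : 'rV[R]_m) : R := \sum_j u 0 j * v 0 j.

Definition sphere_angle m (u v : 'rV[R]_m) : R := acos (euclidean_dot u v).

Definition preSV_point := (R * (forall i : 'I_d, 'rV[R]_(n i)))%type.

Definition preSV : set preSV_point :=
  [set p | 0 < p.1 /\ forall i, euclidean_dot (p.2 i) (p.2 i) = 1].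

(* (lambda, u_1, ..., u_d) |->
     lambda u_1^{(x) k_1} (x) ... (x) u_d^{(x) k_d}, entry by entry *)
Definition tensor_map (p : preSV_point) : tensor :=
  [ffun J : tensor_index => p.1 * \prod_i \prod_(j < k i) p.2 i 0 (J i j)].

Definition segre_veronese : set tensor := tensor_map @` preSV.

Definition representatives (P : tensor) : set preSV_point :=
  preSV `&` tensor_map @^-1` [set P].

Definition Mdist (p q : preSV_point) : R :=
  Num.sqrt (\sum_i (k i)%:R * sphere_angle (p.2 i) (q.2 i) ^+ 2).

Definition compatible (alpha : R) (p q : preSV_point) : Prop :=
  Mdist p q < pi / alpha.

Definition matched (P Q : tensor) (p q : preSV_point) : Prop :=
  [/\ representatives P p, representatives Q q &
      forall p' q', representatives P p' -> representatives Q q' ->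
        Mdist p q <= Mdist p' q'].

(* The ambient metric at A = lambda W, |W| = 1: any X decomposes uniquely as
   X = x W + lambda V with V orthogonal to W, namely x = <X, W> and
   V = (X - x W) / lambda. *)
Definition radial_part (A X : tensor) : R :=
  tensor_dot X ((tensor_norm A)^-1 *: A).

Definition angular_part (A X : tensor) : tensor :=
  (tensor_norm A)^-1 *:
    (X - radial_part A X *: ((tensor_norm A)^-1 *: A)).

Definition warped_metric (alpha : R) (A X Y : tensor) : R :=
  radial_part A X * radial_part A Y +
  (alpha * tensor_norm A) ^+ 2 *
    tensor_dot (angular_part A X) (angular_part A Y).

(* A curve on [a, b] is a total function of which only the values on [a, b]
   matter.  Since the Segre-Veronese manifold is an embedded submanifold,
   smoothness into it is smoothness into the ambient space of tensors. *)
Definition smooth (f : R -> R) : Prop :=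
  forall (m : nat) (t : R), derivable (derive1n m f) t 1.

(* smooth up to the endpoints: each entry has a smooth extension *)
Definition smooth_on (a b : R) (c : R -> tensor) : Prop :=
  forall J, exists2 f : R -> R, smooth f & {in `[a, b], forall t, c t J = f t}.

(* Consecutive pieces share their endpoint, which forces continuity. *)
Definition piecewise_smooth (a b : R) (c : R -> tensor) : Prop :=
  exists2 s : seq R, itv_partition a b s &
    forall i : nat, (i < size s)%N ->
      smooth_on (nth b (a :: s) i) (nth b (a :: s) i.+1) c.

Definition velocity (c : R -> tensor) (t : R) : tensor :=
  [ffun J => derive1 (fun x => c x J) t].

(* The velocity is meaningless at most at a, b and the breakpoints, a null
   set. *)
Definition curve_length (alpha a b : R) (c : R -> tensor) : \bar R :=
  (\int[lebesgue_measure]_(t in `[a, b])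
    (Num.sqrt (warped_metric alpha (c t) (velocity c t) (velocity c t)))%:E)%E.

Definition connecting_curve (P Q : tensor) (a b : R) (c : R -> tensor) : Prop :=
  [/\ a < b, piecewise_smooth a b c,
      {in `[a, b], forall t, segre_veronese (c t)}, c a = P & c b = Q].

Definition intrinsic_distance (alpha : R) (P Q : tensor) : \bar R :=
  ereal_inf [set l | exists a b c,
    connecting_curve P Q a b c /\ l = curve_length alpha a b c].

Definition minimizing_geodesic (alpha : R) (P Q : tensor)
    (a b : R) (c : R -> tensor) : Prop :=
  connecting_curve P Q a b c /\
  curve_length alpha a b c = intrinsic_distance alpha P Q.

End SegreVeronese.

(* Main.v *)
Require Import Defs.
From HB Require Import structures.
From mathcomp Require Import all_boot all_order all_algebra.
From mathcomp Require Import all_classical all_reals all_analysis.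
From mathcomp Require Import measurable_realfun ring lra.
Set Implicit Arguments.
Unset Strict Implicit.
Unset Printing Implicit Defensive.
Import Order.TTheory GRing.Theory Num.Theory.
Import numFieldNormedType.Exports.
Local Open Scope classical_set_scope.
Local Open Scope ring_scope.

(** The map from radius and unit factors to tensors is a Riemannian covering of
   the warped cone over a product of spheres, and in such a cone the distance
   between points of radii lambda and mu at angle beta is the side of a plane
   triangle when beta < pi, and lambda + mu, reached only through the missing
   apex, when beta >= pi.  Here beta is alpha times the distance Mdist of
   matched representatives.

   Lower bound.  No curve is lifted.  Fix a representative p of P and draw a
   tensor A in the plane at radius |A| and at polar angle alpha times the least
   Mdist from p to a representative of A, capped at some beta
   ([unrolled_angle]).  Two nearby tensors A and B at cosine x have
   representatives with Mdist ^ 2 <= - 2 ln x ([near_representative]), because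
   cos t <= exp (- t ^ 2 / 2), and Mdist satisfies the triangle inequality
   ([Mdist_triangle]); hence the plane chord, squared and multiplied by x, is at
   most [chord_form], a form in |A| - |B| and |A - B| whose difference quotients
   along a curve tend to the squared speed ([unrolled_chord],
   [chord_form_derivative]).  So every linear coordinate of the unrolled curve
   is locally Lipschitz with constant the speed, and an interval induction gives
   that its variation is at most the length ([local_lipschitz_integral],
   [piecewise_smooth_variation]).  Read along the side of the triangle, this is
   the bound by the length of that side ([curve_length_ge]).  If beta can be
   taken equal to pi, the unrolled curve meets the angle pi / 2 off the apex, and
   the parts before and after that point are longer than the radii of P and Q,
   so that the length exceeds lambda + mu strictly ([curve_length_gt]).

   Upper bound.  Rotate all factors simultaneously along great circles, by a
   fraction of their angles proportional to atan y, while the radius is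
   kappa sqrt (1 + y ^ 2).  When the total turn of the polar angle atan y equals
   beta this is the side of the triangle; for kappa tending to 0 it approaches
   the broken line through the apex.  One estimate covers both cases
   ([exists_hyperbolic_curve]).

   A matched pair always exists because the representatives of a tensor differ
   by signs of the factors ([exists_matched]).  If it is compatible, the side of
   the triangle is a minimizing geodesic; otherwise the distance is
   at most lambda + mu and every curve is longer. *)

(** * Elementary inequalities *)

Lemma is_derive_continuous (R : realType) (f : R -> R) (t df : R) :
  is_derive t 1 f df -> {for t, continuous f}.
Proof. by case=> /derivable1_diffP/differentiable_continuous. Qed.

Lemma sin_le (R : realType) (t : R) : 0 <= t -> sin t <= t.
Proof.
move=> t0; rewrite -subr_ge0.
have dh (x : R) : is_derive x 1 (fun y => y - sin y) (1 - cos x).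
  by apply: is_derive_eq.
have := @ger0_derive1_ndecry R (fun y => y - sin y) 0 _ _ _ 0 t (lexx _) t0.
rewrite sin0 subr0; apply.
- by move=> x _; apply: ex_derive.
- by move=> x _; rewrite derive1E derive_val subr_ge0 cos_le1.
- by apply: continuous_subspaceT => x; exact: is_derive_continuous (dh x).
Qed.

Lemma one_sub_cos_le (R : realType) (t : R) : 1 - cos t <= t ^+ 2 / 2.
Proof.
wlog t0 : t / 0 <= t.
  move=> h; case: (leP 0 t) => [/h//|t0].
  by rewrite -cosN -sqrrN; apply: h; rewrite oppr_ge0 ltW.
have dh (x : R) : is_derive x 1 (fun y => y ^+ 2 / 2 + cos y) (x - sin x).
  apply: is_derive_eq; rewrite /GRing.scale/= /GRing.exp/=; by field.
rewrite lerBlDr.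
have := @ger0_derive1_ndecry R (fun y => y ^+ 2 / 2 + cos y)
  0 _ _ _ 0 t (lexx _) t0.
rewrite cos0 expr0n/= mul0r add0r; apply.
- by move=> x _; apply: ex_derive.
- move=> x; rewrite in_itv/= andbT => x0.
  by rewrite derive1E derive_val subr_ge0 sin_le// ltW.
- by apply: continuous_subspaceT => x; exact: is_derive_continuous (dh x).
Qed.

Lemma cos_mul_le_sin (R : realType) (t : R) : 0 <= t <= pi / 2 ->
  t * cos t <= sin t.
Proof.
move=> /andP[t0 tpi]; rewrite -subr_ge0.
have dh (x : R) : is_derive x 1 (fun y => sin y - y * cos y) (x * sin x).
  apply: is_derive_eq; rewrite /GRing.scale/=; ring.
have := @ger0_derive1_le_cc R (fun y => sin y - y * cos y) 0 t _ _ _ 0 t.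
rewrite sin0 mul0r subr0; apply.
- by move=> x _; apply: ex_derive.
- move=> x; rewrite in_itv/= => /andP[x0 xt].
  rewrite derive1E derive_val mulr_ge0//; first exact: ltW.
  by apply: sin_ge0_pi; have := pi_ge0 R; lra.
- by apply: continuous_subspaceT => x; exact: is_derive_continuous (dh x).
- by rewrite in_itv/= lexx.
- by rewrite in_itv/= lexx t0.
- by [].
Qed.

(** The quotient of the two sides decreases, because t cos t <= sin t. *)
Lemma cos_le_expR (R : realType) (t : R) : 0 <= t <= pi / 2 ->
  cos t <= expR (- (t ^+ 2 / 2)).
Proof.
move=> /andP[t0 tpi].
have dh (x : R) : is_derive x 1 (fun y => cos y * expR (y ^+ 2 / 2))
    ((x * cos x - sin x) * expR (x ^+ 2 / 2)).
  apply: is_derive_eq; rewrite /GRing.scale/= /GRing.exp/=; by field.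
rewrite expRN -[_^-1]mul1r ler_pdivlMr ?expR_gt0//.
have := @ler0_derive1_le_cc R (fun y => cos y * expR (y ^+ 2 / 2)) 0 t _ _ _ t 0.
rewrite cos0 expr0n/= mul0r expR0 mul1r; apply.
- by move=> x _; apply: ex_derive.
- move=> x; rewrite in_itv/= => /andP[x0 xt].
  rewrite derive1E derive_val mulr_le0_ge0// ?expR_ge0// subr_le0.
  by apply: cos_mul_le_sin; lra.
- by apply: continuous_subspaceT => x; exact: is_derive_continuous (dh x).
- by rewrite in_itv/= lexx t0.
- by rewrite in_itv/= lexx t0.
- by [].
Qed.

Lemma mul_ln_ge (R : realType) (x : R) : 0 < x -> - (x * ln x) <= 1 - x.
Proof.
move=> x0; have : ln x^-1 <= x^-1 - 1.
  rewrite -{1}(subrK 1 x^-1) addrC; apply: le_ln1Dx.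
  by rewrite ltrBrDl subrr invr_gt0.
rewrite lnV ?posrE// => /(ler_wpM2l (ltW x0)).
by rewrite mulrBr divff ?gt_eqF// mulr1 mulrN.
Qed.

(** Telescoping: 1 - x y = (1 - x) + x (1 - y). *)
Lemma one_sub_prod_le (R : realType) (I : Type) (s : seq I) (P : pred I)
    (f : I -> R) :
  (forall i, `|f i| <= 1) ->
  1 - \prod_(i <- s | P i) f i <= \sum_(i <- s | P i) (1 - f i).
Proof.
move=> f1.
suff : `|\prod_(i <- s | P i) f i| <= 1 /\
  1 - \prod_(i <- s | P i) f i <= \sum_(i <- s | P i) (1 - f i) by case.
elim/big_rec2: _ => [|i x y _ [x1 xy]]; first by rewrite normr1 subrr.
split; first by rewrite normrM mulr_ile1.
move: (f1 i) x1; rewrite !ler_norml => /andP[? ?] /andP[? ?]; nra.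
Qed.

(** * Angles on spheres *)

Section EuclideanSphere.
Variables (R : realType) (m : nat).
Implicit Types (u v w : 'rV[R]_m) (a : R).

Local Notation dot := (@euclidean_dot R m).

Lemma euclidean_dotC u v : dot u v = dot v u.
Proof. by apply: eq_bigr => j _; rewrite mulrC. Qed.

Lemma euclidean_dotDl u v w : dot (u + v) w = dot u w + dot v w.
Proof. by rewrite -big_split; apply: eq_bigr => j _; rewrite mxE mulrDl. Qed.

Lemma euclidean_dotZl a u v : dot (a *: u) v = a * dot u v.
Proof.
by rewrite /euclidean_dot mulr_sumr; apply: eq_bigr => j _; rewrite mxE mulrA.
Qed.

Lemma euclidean_dotDr u v w : dot u (v + w) = dot u v + dot u w.
Proof. by rewrite euclidean_dotC euclidean_dotDl !(euclidean_dotC u). Qed.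

Lemma euclidean_dotZr a u v : dot u (a *: v) = a * dot u v.
Proof. by rewrite euclidean_dotC euclidean_dotZl euclidean_dotC. Qed.

Lemma euclidean_dot_ge0 u : 0 <= dot u u.
Proof. by apply: sumr_ge0 => j _; rewrite -expr2 sqr_ge0. Qed.

Lemma euclidean_dot_eq0 u : dot u u = 0 -> u = 0.
Proof.
move=> /eqP; rewrite psumr_eq0 => [/allP h|j _]; last by rewrite -expr2 sqr_ge0.
apply/rowP => j; rewrite mxE; apply/eqP.
by have := h j (mem_index_enum _); rewrite /= -expr2 sqrf_eq0.
Qed.

Lemma unit_dot_bounds u v : dot u u = 1 -> dot v v = 1 -> -1 <= dot u v <= 1.
Proof.
move=> u1 v1; have := euclidean_dot_ge0 (u + v).
have := euclidean_dot_ge0 (u + (-1) *: v).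
rewrite !(euclidean_dotDl, euclidean_dotDr, euclidean_dotZl, euclidean_dotZr).
rewrite u1 v1 (euclidean_dotC v u) => h1 h2; lra.
Qed.

Lemma unit_dot_sqr1 u v : dot u u = 1 -> dot v v = 1 -> dot u v ^+ 2 = 1 ->
  v = dot u v *: u.
Proof.
move=> u1 v1 uv; apply/eqP; rewrite -subr_eq0 -scaleN1r; apply/eqP.
apply: euclidean_dot_eq0.
rewrite !(euclidean_dotDl, euclidean_dotDr, euclidean_dotZl, euclidean_dotZr).
rewrite u1 v1 (euclidean_dotC v u); ring: uv.
Qed.

Lemma sphere_angle_bounds u v : dot u u = 1 -> dot v v = 1 ->
  0 <= sphere_angle u v <= pi.
Proof.
by move=> u1 v1; rewrite acos_ge0 ?acos_lepi// unit_dot_bounds.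
Qed.

Lemma cos_sphere_angle u v : dot u u = 1 -> dot v v = 1 ->
  cos (sphere_angle u v) = dot u v.
Proof. by move=> u1 v1; rewrite acosK// in_itv/= unit_dot_bounds. Qed.

Lemma sphere_angleuu u : dot u u = 1 -> sphere_angle u u = 0.
Proof. by rewrite /sphere_angle => ->; rewrite acos1. Qed.

Lemma exists_orthogonal_unit u : (2 <= m)%N ->
  exists w, dot w w = 1 /\ dot u w = 0.
Proof.
move=> m2.
have /rowV0Pn[w /sub_kermxP wu w0] : kermx u^T != 0.
  rewrite -mxrank_eq0 mxrank_ker -lt0n subn_gt0.
  exact: leq_ltn_trans (rank_leq_col _) m2.
have ww : 0 < dot w w.
  rewrite lt_neqAle euclidean_dot_ge0 andbT eq_sym.
  by apply: contra_neq w0 => /euclidean_dot_eq0.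
exists ((Num.sqrt (dot w w))^-1 *: w); split.
  rewrite euclidean_dotZl euclidean_dotZr mulrA -expr2 exprVn sqr_sqrtr ?ltW//.
  by rewrite mulVf// gt_eqF.
rewrite euclidean_dotZr euclidean_dotC.
have -> : dot w u = (w *m u^T) 0 0.
  by rewrite mxE; apply: eq_bigr => j _; rewrite mxE.
by rewrite wu mxE mulr0.
Qed.

(** When v is u or - u the sine vanishes and any unit vector orthogonal to u
   serves as direction; such a vector exists in dimension at least 2. *)
Lemma great_circle u v : (2 <= m)%N -> dot u u = 1 -> dot v v = 1 ->
  exists w, [/\ dot w w = 1, dot u w = 0 &
    v = cos (sphere_angle u v) *: u + sin (sphere_angle u v) *: w].
Proof.
move=> m2 u1 v1; set t := sphere_angle u v.
have ct : cos t = dot u v by exact: cos_sphere_angle.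
have := cos2Dsin2 t; have [s0|s0] := eqVneq (sin t) 0 => tt.
  have [w [w1 uw]] := exists_orthogonal_unit u m2.
  exists w; split => //; rewrite s0 scale0r addr0 ct; apply: unit_dot_sqr1 => //.
  by rewrite -ct -tt s0 expr0n addr0.
exists ((sin t)^-1 *: (v + (- cos t) *: u)); split.
- rewrite !(euclidean_dotDl, euclidean_dotDr, euclidean_dotZl, euclidean_dotZr).
  rewrite u1 v1 (euclidean_dotC v u) -ct.
  transitivity ((sin t)^-1 ^+ 2 * (1 - cos t ^+ 2)); first by ring.
  have -> : 1 - cos t ^+ 2 = sin t ^+ 2 by rewrite -tt; ring.
  by field.
- rewrite !(euclidean_dotDr, euclidean_dotZr) u1 -ct; ring.
- rewrite scalerA divff// scale1r addrCA -scalerDl subrr scale0r addr0 //.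
Qed.

(** With u and w written along great circles through v, the inner product of
   the two directions is at least -1, hence <u, w> is at least the cosine of
   the sum of the angles. *)
Lemma sphere_angle_triangle u v w : (2 <= m)%N ->
  dot u u = 1 -> dot v v = 1 -> dot w w = 1 ->
  sphere_angle u w <= sphere_angle u v + sphere_angle v w.
Proof.
move=> m2 u1 v1 w1.
have [x [x1 vx]] := great_circle m2 v1 u1.
have [y [y1 vy]] := great_circle m2 v1 w1.
rewrite /(sphere_angle u v) (euclidean_dotC u v) -/(sphere_angle v u).
set A := sphere_angle v u; set B := sphere_angle v w => wE uE.
have /andP[A0 Api] : 0 <= A <= pi by exact: sphere_angle_bounds.
have /andP[B0 Bpi] : 0 <= B <= pi by exact: sphere_angle_bounds.
have /andP[C0 Cpi] := sphere_angle_bounds u1 w1.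
have [AB|AB] := leP pi (A + B); first exact: le_trans AB.
rewrite leNgt -ltr_cos ?in_itv/= ?C0 ?Cpi ?addr_ge0 ?(ltW AB)// -leNgt.
rewrite cos_sphere_angle// {1}uE wE.
rewrite !(euclidean_dotDl, euclidean_dotDr, euclidean_dotZl, euclidean_dotZr).
rewrite v1 (euclidean_dotC x v) vx vy cosD.
have /andP[xy _] := unit_dot_bounds x1 y1.
have sA : 0 <= sin A by apply: sin_ge0_pi; rewrite A0.
have sB : 0 <= sin B by apply: sin_ge0_pi; rewrite B0.
have := mulr_ge0 sA sB; nra.
Qed.

End EuclideanSphere.

Lemma weighted_minkowski (R : realType) (I : finType) (k a b : I -> R) :
  (forall i, 0 <= k i) ->
  Num.sqrt (\sum_i k i * (a i + b i) ^+ 2) <=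
  Num.sqrt (\sum_i k i * a i ^+ 2) + Num.sqrt (\sum_i k i * b i ^+ 2).
Proof.
move=> k0; set SA := \sum_i k i * a i ^+ 2; set SB := \sum_i k i * b i ^+ 2.
have nn (f : I -> R) : 0 <= \sum_i k i * f i ^+ 2.
  by apply: sumr_ge0 => i _; rewrite mulr_ge0// sqr_ge0.
set X := Num.sqrt SA; set Y := Num.sqrt SB.
have X0 : 0 <= X by exact: sqrtr_ge0.
have Y0 : 0 <= Y by exact: sqrtr_ge0.
have XX : X ^+ 2 = SA by rewrite sqr_sqrtr// nn.
have YY : Y ^+ 2 = SB by rewrite sqr_sqrtr// nn.
pose C := \sum_i k i * (a i * b i).
have SE s t : \sum_i k i * (s * a i + t * b i) ^+ 2 =
    s ^+ 2 * SA + t ^+ 2 * SB + 2 * s * t * C.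
  rewrite /SA /SB /C !mulr_sumr -!big_split; apply: eq_bigr => i _ /=; ring.
have CXY : C <= X * Y.
  have := nn (fun i => Y * a i + (- X) * b i); rewrite SE -XX -YY => h.
  have [XY|XY] := eqVneq (X * Y) 0; last first.
    have XY0 : 0 < X * Y by rewrite lt_neqAle eq_sym XY mulr_ge0.
    rewrite -subr_ge0; rewrite -(pmulr_rge0 _ XY0); nra.
  rewrite XY leNgt; apply/negP => C0.
  have SA0 : 0 <= SA by exact: nn.
  have SB0 : 0 <= SB by exact: nn.
  have SAB : SA * SB = 0 by rewrite -XX -YY -exprMn XY expr0n.
  (* a vanishing quadratic coefficient leaves an affine form in the other
     variable, which takes negative values unless C is nonpositive *)
  have := nn (fun i => ((SB + 1) / C) * a i + (- 1) * b i).
  have := nn (fun i => (- 1) * a i + ((SA + 1) / C) * b i).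
  rewrite !SE => h1 h2.
  move/eqP: SAB; rewrite mulf_eq0 => /orP[] /eqP S0.
    have : 2 * ((SB + 1) / C) * -1 * C = - 2 * (SB + 1) by field; rewrite gt_eqF.
    move: h2; rewrite S0; lra.
  have : 2 * -1 * ((SA + 1) / C) * C = - 2 * (SA + 1) by field; rewrite gt_eqF.
  move: h1; rewrite S0; lra.
rewrite -(@ler_pXn2r _ 2) ?nnegrE ?addr_ge0 ?sqrtr_ge0//.
rewrite sqr_sqrtr ?nn// sqrrD XX YY.
have := SE 1 1; under eq_bigr do rewrite !mul1r; move=> ->.
rewrite -mulr_natl; lra.
Qed.

Section Mdist.
Variables (R : realType) (d : nat) (n k : 'I_d -> nat).
Hypothesis hn : forall i, (2 <= n i)%N.
Implicit Types p q r : preSV_point R n.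

Lemma Mdist_ge0 p q : 0 <= Mdist k p q. Proof. exact: sqrtr_ge0. Qed.

Lemma Mdist_sqr p q :
  Mdist k p q ^+ 2 = \sum_i (k i)%:R * sphere_angle (p.2 i) (q.2 i) ^+ 2.
Proof.
by rewrite sqr_sqrtr//; apply: sumr_ge0 => i _; rewrite mulr_ge0 ?sqr_ge0.
Qed.

Lemma Mdistpp p : preSV p -> Mdist k p p = 0.
Proof.
move=> [_ p1]; rewrite /Mdist big1 ?sqrtr0// => i _.
by rewrite sphere_angleuu// expr0n mulr0.
Qed.

Lemma Mdist_triangle p q r : preSV p -> preSV q -> preSV r ->
  Mdist k p r <= Mdist k p q + Mdist k q r.
Proof.
move=> [_ p1] [_ q1] [_ r1].
apply: le_trans (weighted_minkowski _ _ _) => [|i]; last exact: ler0n.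
apply: ler_wsqrtr; apply: ler_sum => i _; apply: ler_wpM2l => //.
have /andP[h0 _] := sphere_angle_bounds (p1 i) (r1 i).
by rewrite ler_sqr ?nnegrE ?(le_trans h0) ?sphere_angle_triangle//.
Qed.

End Mdist.

(** * The tensors of a product of spheres *)

(** Dependent functions are read as functions into a sigma type, over which
   products of sums distribute. *)
Lemma sum_dffun_prod (R : comPzRingType) (I : finType) (T : I -> finType)
    (G : forall i, T i -> R) :
  \sum_(J : {dffun forall i, T i}) \prod_i G i (J i) =
  \prod_i \sum_(f : T i) G i f.
Proof.
rewrite (reindex (@dffun_of_fprod _ T)); last exact/onW_bij/dffun_of_fprod_bij.
pose P i := [ffun f : T i => G i f].
transitivity (\sum_(t : fprod T) \prod_(i in I) P i (t i)).
  by apply: eq_bigr => t _; apply: eq_bigr => i _; rewrite !ffunE.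
rewrite big_fprod.
rewrite -(bigA_distr_big_dep (fun i => tagged_with T i)
  (fun i => untag 0 (P i))).
apply: eq_bigr => i _; rewrite -(@big_tag _ _ _ _ T (fun i => P i) i).
by apply: eq_bigr => f _; rewrite ffunE.
Qed.

Section TensorAlgebra.
Variables (R : realType) (d : nat) (n k : 'I_d -> nat).
Implicit Types (A B X Y : tensor R n k) (p q : preSV_point R n).

Lemma tensor_dotC A B : tensor_dot A B = tensor_dot B A.
Proof. by apply: eq_bigr => J _; rewrite mulrC. Qed.

Lemma tensor_dotDl A B X : tensor_dot (A + B) X = tensor_dot A X + tensor_dot B X.
Proof. by rewrite -big_split; apply: eq_bigr => J _; rewrite ffunE mulrDl. Qed.

Lemma tensor_dotZl (a : R) A B : tensor_dot (a *: A) B = a * tensor_dot A B.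
Proof.
by rewrite /tensor_dot mulr_sumr; apply: eq_bigr => J _; rewrite ffunE mulrA.
Qed.

Lemma tensor_dotDr A B X : tensor_dot A (B + X) = tensor_dot A B + tensor_dot A X.
Proof. by rewrite tensor_dotC tensor_dotDl !(tensor_dotC A). Qed.

Lemma tensor_dotZr (a : R) A B : tensor_dot A (a *: B) = a * tensor_dot A B.
Proof. by rewrite tensor_dotC tensor_dotZl tensor_dotC. Qed.

Lemma tensor_dot_ge0 A : 0 <= tensor_dot A A.
Proof. by apply: sumr_ge0 => J _; rewrite -expr2 sqr_ge0. Qed.

Lemma tensor_norm_sqr A : tensor_norm A ^+ 2 = tensor_dot A A.
Proof. by rewrite sqr_sqrtr// tensor_dot_ge0. Qed.

Lemma tensor_dotBB A B : tensor_dot (A - B) (A - B) =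
  tensor_norm A ^+ 2 + tensor_norm B ^+ 2 - 2 * tensor_dot A B.
Proof.
rewrite -scaleN1r !(tensor_dotDl, tensor_dotDr, tensor_dotZl, tensor_dotZr).
rewrite !tensor_norm_sqr (tensor_dotC B A); ring.
Qed.

Lemma tensor_dot_map p q :
  tensor_dot (tensor_map k p) (tensor_map k q) =
  p.1 * q.1 * \prod_i euclidean_dot (p.2 i) (q.2 i) ^+ k i.
Proof.
pose G i (f : {ffun 'I_(k i) -> 'I_(n i)}) :=
  \prod_(j < k i) (p.2 i 0 (f j) * q.2 i 0 (f j)).
have GE : \prod_i euclidean_dot (p.2 i) (q.2 i) ^+ k i = \prod_i \sum_f @G i f.
  apply: eq_bigr => i _.
  rewrite /G -(bigA_distr_bigA (fun _ l => p.2 i 0 l * q.2 i 0 l)) /=.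
  by rewrite big_const card_ord iter_mulr_1.
rewrite GE -sum_dffun_prod /tensor_dot mulr_sumr; apply: eq_bigr => J _.
rewrite !ffunE mulrACA; congr (_ * _).
rewrite -big_split /=; apply: eq_bigr => i _; by rewrite /G big_split.
Qed.

Lemma tensor_norm_map p : preSV p -> tensor_norm (tensor_map k p) = p.1.
Proof.
move=> [p0 p1]; rewrite /tensor_norm tensor_dot_map.
rewrite big1 ?mulr1 -?expr2 ?sqrtr_sqr ?gtr0_norm// => i _.
by rewrite p1 expr1n.
Qed.

Lemma segre_veronese_norm_gt0 A : segre_veronese A -> 0 < tensor_norm A.
Proof. by move=> [p pp <-]; rewrite tensor_norm_map//; case: pp. Qed.

(** The squared speed is the limit of the difference quotients of this form,
   whose two parts are the radial and the angular displacement. *)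
Definition chord_form (alpha : R) A B : R :=
  (tensor_norm A - tensor_norm B) ^+ 2 + alpha ^+ 2 *
   (tensor_dot (A - B) (A - B) - (tensor_norm A - tensor_norm B) ^+ 2).

Definition tensor_cos A B : R :=
  tensor_dot A B / (tensor_norm A * tensor_norm B).

Lemma chord_formE alpha A B : 0 < tensor_norm A -> 0 < tensor_norm B ->
  chord_form alpha A B = (tensor_norm A - tensor_norm B) ^+ 2 +
    2 * alpha ^+ 2 * (tensor_norm A * tensor_norm B) * (1 - tensor_cos A B).
Proof.
move=> A0 B0; rewrite /chord_form /tensor_cos tensor_dotBB; field.
by rewrite !gt_eqF.
Qed.

Lemma tensor_cos_map p q : preSV p -> preSV q ->
  tensor_cos (tensor_map k p) (tensor_map k q) =
  \prod_i euclidean_dot (p.2 i) (q.2 i) ^+ k i.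
Proof.
move=> pp qq; rewrite /tensor_cos !tensor_norm_map// tensor_dot_map.
by rewrite mulrC mulrA mulVf ?mul1r// mulf_neq0// gt_eqF//; [case: pp|case: qq].
Qed.

Lemma warped_metricE (alpha : R) A X : 0 < tensor_norm A ->
  warped_metric alpha A X X =
  (tensor_dot X A / tensor_norm A) ^+ 2 +
  alpha ^+ 2 * (tensor_dot X X - (tensor_dot X A / tensor_norm A) ^+ 2).
Proof.
move=> A0; have AA := tensor_norm_sqr A; move: A0 AA.
rewrite /warped_metric /angular_part /radial_part.
set N := tensor_norm A => N0 AA.
rewrite -scaleN1r.
rewrite !(tensor_dotDl, tensor_dotDr, tensor_dotZl, tensor_dotZr).
rewrite -AA (tensor_dotC A X); field.
by rewrite gt_eqF.
Qed.

Lemma warped_metric_ge0 (alpha : R) A X : 0 <= warped_metric alpha A X X.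
Proof.
apply: addr_ge0; first by rewrite -expr2 sqr_ge0.
by rewrite mulr_ge0 ?sqr_ge0 ?tensor_dot_ge0.
Qed.

End TensorAlgebra.

(** * Representatives and the unrolled angle *)

Section Representatives.
Variables (R : realType) (d : nat) (n k : 'I_d -> nat).
Hypothesis hn : forall i, (2 <= n i)%N.
Hypothesis hk : forall i, (1 <= k i)%N.
Implicit Types (A B P Q : tensor R n k) (p q r : preSV_point R n).

Definition rescale (s : 'I_d -> R) p : preSV_point R n :=
  (p.1, fun i => s i *: p.2 i).

Lemma tensor_map_rescale s p :
  tensor_map k (rescale s p) = (\prod_i s i ^+ k i) *: tensor_map k p.
Proof.
apply/ffunP => J; rewrite !ffunE /= [in RHS]/GRing.scale/= mulrCA; congr (_ * _).
rewrite -big_split; apply: eq_bigr => i _ /=.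
have -> : s i ^+ k i = \prod_(j < k i) s i by rewrite big_const card_ord iter_mulr_1.
by rewrite -big_split; apply: eq_bigr => j _; rewrite mxE.
Qed.

Lemma preSV_rescale s p : (forall i, s i ^+ 2 = 1) -> preSV p ->
  preSV (rescale s p).
Proof.
move=> s1 [p0 p1]; split => // i.
by rewrite /= euclidean_dotZl euclidean_dotZr mulrA p1 -expr2 s1 mulr1.
Qed.

Lemma representative_segre A p : representatives A p -> segre_veronese A.
Proof. by move=> [pp /= <-]; exists p. Qed.

Lemma segre_veroneseP A : segre_veronese A -> exists p, representatives A p.
Proof. by move=> [p pp <-]; exists p. Qed.

(** Flipping the signs of the factors of B so that every angle to the
   corresponding factor of A is acute leaves B unchanged as soon as A and B
   make an acute angle; the logarithm of the cosine of that angle is then the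
   sum of those of the factors, and [cos_le_expR] bounds each of them. *)
Lemma near_representative A B q : representatives A q -> segre_veronese B ->
  0 < tensor_cos A B ->
  exists2 q', representatives B q' &
    Mdist k q q' ^+ 2 <= - 2 * ln (tensor_cos A B).
Proof.
move=> [qq <-] [r rr <-]; rewrite tensor_cos_map//.
pose x i := euclidean_dot (q.2 i) (r.2 i); rewrite -/(x _).
rewrite -[\prod_i _]/(\prod_i x i ^+ k i) => x_gt0.
have x0 i : x i != 0.
  apply: contraTneq x_gt0 => xi; rewrite (bigD1 i)//= xi expr0n.
  by rewrite gtn_eqF ?hk// mul0r ltxx.
pose r' := rescale (fun i => Num.sg (x i)) r.
have sg2 i : Num.sg (x i) ^+ 2 = 1 by rewrite sqr_sg x0.
have rr' : preSV r' by exact: preSV_rescale.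
have xr i : euclidean_dot (q.2 i) (r'.2 i) = `|x i|.
  by rewrite /= euclidean_dotZr normrEsg.
exists r'; first split => //=.
  rewrite tensor_map_rescale.
  have -> : \prod_i Num.sg (x i) ^+ k i = Num.sg (\prod_i x i ^+ k i).
    rewrite (big_morph Num.sg (@sgrM _) (@sgr1 _)).
    by apply: eq_bigr => i _; rewrite sgrX.
  by rewrite gtr0_sg// scale1r.
have -> : \prod_i x i ^+ k i = \prod_i `|x i| ^+ k i.
  by rewrite -[LHS]gtr0_norm// normr_prod; apply: eq_bigr => i _; rewrite normrX.
have [[_ q1] [_ r1]] := (qq, rr').
have angle i : `|x i| <= expR (- (sphere_angle (q.2 i) (r'.2 i) ^+ 2 / 2)).
  rewrite -xr -cos_sphere_angle//; apply: cos_le_expR.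
  have /andP[t0 tpi] := sphere_angle_bounds (q1 i) (r1 i).
  rewrite t0 leNgt; apply/negP => t_gt.
  have : cos (sphere_angle (q.2 i) (r'.2 i)) < cos (pi / 2).
    rewrite ltr_cos// in_itv/= ?t0//; apply/andP; have := pi_ge0 R; split; lra.
  by rewrite cos_pihalf cos_sphere_angle// xr ltNge normr_ge0.
rewrite Mdist_sqr.
have : ln (\prod_i `|x i| ^+ k i) <= ln (expR
    (- ((\sum_i (k i)%:R * sphere_angle (q.2 i) (r'.2 i) ^+ 2) / 2))).
  rewrite ler_ln ?posrE ?expR_gt0 ?prodr_gt0//; last first.
    by move=> i _; rewrite exprn_gt0// normr_gt0.
  rewrite -mulrN mulr_suml expR_sum; apply: ler_prod => i _.
  rewrite exprn_ge0//= -mulrA expRM_natl mulrN.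
  by apply: lerXn2r; rewrite ?nnegrE ?normr_ge0 ?expR_ge0.
rewrite expRK; lra.
Qed.

Section AngularDistance.
Variable p : preSV_point R n.
Hypothesis pp : preSV p.

Definition angular_distance A : R :=
  inf [set Mdist k p q | q in representatives A].

Lemma angular_distance_has_inf A : segre_veronese A ->
  has_inf [set Mdist k p q | q in representatives A].
Proof.
move=> /segre_veroneseP[q qA]; split; first by exists (Mdist k p q), q.
by exists 0 => _ [r _ <-]; exact: Mdist_ge0.
Qed.

Lemma angular_distance_le A q : representatives A q ->
  angular_distance A <= Mdist k p q.
Proof.
move=> qA; apply: ge_inf; last by exists q.
exact: (angular_distance_has_inf (representative_segre qA)).2.
Qed.

Lemma angular_distance_ge A (m : R) : segre_veronese A ->
  (forall q, representatives A q -> m <= Mdist k p q) ->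
  m <= angular_distance A.
Proof.
move=> AS h; apply: lb_le_inf; first exact: (angular_distance_has_inf AS).1.
by move=> _ [q qA <-]; exact: h.
Qed.

Lemma angular_distance_ge0 A : segre_veronese A -> 0 <= angular_distance A.
Proof. by move=> AS; apply: angular_distance_ge => // q _; exact: Mdist_ge0. Qed.

Lemma angular_distancep : angular_distance (tensor_map k p) = 0.
Proof.
apply/eqP; rewrite eq_le angular_distance_ge0 ?andbT; last by exists p.
by rewrite -(Mdistpp k pp); apply: angular_distance_le.
Qed.

Lemma angular_distance_lipschitz A B : segre_veronese A -> segre_veronese B ->
  0 < tensor_cos A B ->
  (angular_distance A - angular_distance B) ^+ 2 <= - 2 * ln (tensor_cos A B).
Proof.
have half A' B' : segre_veronese A' -> segre_veronese B' -> 0 < tensor_cos A' B' ->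
    angular_distance B' <=
      angular_distance A' + Num.sqrt (- 2 * ln (tensor_cos A' B')).
  move=> AS BS x0; rewrite -lerBlDr; apply: angular_distance_ge => // q qA.
  have [q' qB qq'] := near_representative qA BS x0.
  rewrite lerBlDr; apply: le_trans (angular_distance_le qB) _.
  apply: le_trans (@Mdist_triangle _ _ _ k hn _ _ _ pp qA.1 qB.1) _.
  by rewrite lerD2l -[leLHS]ger0_norm ?Mdist_ge0// -sqrtr_sqr ler_wsqrtr.
move=> AS BS x0.
have xC : tensor_cos B A = tensor_cos A B.
  by rewrite /tensor_cos tensor_dotC (mulrC (tensor_norm B)).
have l0 : 0 <= - 2 * ln (tensor_cos A B).
  have [q qA] := segre_veroneseP AS.
  have [q' _] := near_representative qA BS x0; exact: le_trans (sqr_ge0 _).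
have h1 := half A B AS BS x0.
have := half B A BS AS; rewrite xC => /(_ x0) h2.
rewrite -real_normK ?num_real// -(sqr_sqrtr l0).
rewrite ler_sqr ?nnegrE ?sqrtr_ge0// ler_norml; apply/andP; split; lra.
Qed.

Variables alpha beta : R.
Hypothesis alpha0 : 0 < alpha.

(** The polar angle at which A is drawn in the plane.  The cap lets a lower
   bound beta for the angle of an endpoint serve as its exact value. *)
Definition unrolled_angle A : R := Num.min (alpha * angular_distance A) beta.

Lemma unrolled_angle_lipschitz A B : segre_veronese A -> segre_veronese B ->
  0 < tensor_cos A B ->
  (unrolled_angle A - unrolled_angle B) ^+ 2 <=
    alpha ^+ 2 * (- 2 * ln (tensor_cos A B)).
Proof.
move=> AS BS x0.
apply: le_trans (ler_wpM2l (sqr_ge0 alpha) (angular_distance_lipschitz AS BS x0)).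
rewrite -exprMn mulrBr -(real_normK (num_real (_ - _))).
rewrite -[leRHS](real_normK (num_real _)).
rewrite ler_sqr ?nnegrE ?normr_ge0// /unrolled_angle !minElt.
set a := alpha * _; set b := alpha * _.
have := ler_norm (a - b); have := lerNnormlW (lexx `|a - b|).
case: ltP => h1; case: ltP => h2 h3 h4; rewrite ler_norml; apply/andP; split; lra.
Qed.

(** The plane is probed by its linear coordinates: all chord estimates then
   concern real-valued functions. *)
Definition unrolled_coordinate (e1 e2 : R) A : R := tensor_norm A *
  (e1 * cos (unrolled_angle A) + e2 * sin (unrolled_angle A)).

(** To first order the unrolling does not increase lengths.  The square of the
   angle is at most - 2 alpha ^ 2 ln x at cosine x, and the factor x turns this
   into the angular part of the chord form because - x ln x <= 1 - x. *)
Lemma unrolled_chord A B (e1 e2 : R) : segre_veronese A -> segre_veronese B ->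
  e1 ^+ 2 + e2 ^+ 2 = 1 -> 0 < tensor_cos A B ->
  (unrolled_coordinate e1 e2 A - unrolled_coordinate e1 e2 B) ^+ 2 *
    tensor_cos A B <= chord_form alpha A B.
Proof.
move=> AS BS e1e2 x0; set g := unrolled_coordinate e1 e2.
have A0 := segre_veronese_norm_gt0 AS; have B0 := segre_veronese_norm_gt0 BS.
rewrite chord_formE//.
have x1 : tensor_cos A B <= 1.
  have [q qA] := segre_veroneseP AS.
  have [q' _ /(le_trans (sqr_ge0 _)) h] := near_representative qA BS x0.
  by rewrite leNgt; apply/negP => /ln_gt0; lra.
set a := unrolled_angle A; set b := unrolled_angle B.
set N := tensor_norm A; set M := tensor_norm B; set x := tensor_cos A B.
have chord : (g A - g B) ^+ 2 <= (N - M) ^+ 2 + N * M * (a - b) ^+ 2.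
  apply: (@le_trans _ _ ((N - M) ^+ 2 + N * M * (2 * (1 - cos (a - b))))).
    rewrite -subr_ge0; have := sqr_ge0
      (e1 * (N * sin a - M * sin b) - e2 * (N * cos a - M * cos b)).
    congr (0 <= _).
    transitivity ((e1 ^+ 2 + e2 ^+ 2) * (N ^+ 2 * (cos a ^+ 2 + sin a ^+ 2) +
        M ^+ 2 * (cos b ^+ 2 + sin b ^+ 2) - 2 * N * M * cos (a - b)) -
      (g A - g B) ^+ 2); last by rewrite e1e2 !cos2Dsin2; ring.
    rewrite cosB /g /unrolled_coordinate -/a -/b -/N -/M; ring.
  rewrite lerD2l ler_wpM2l ?mulr_ge0 ?(ltW A0) ?(ltW B0)//.
  by have := one_sub_cos_le (a - b); lra.
have h1 : (a - b) ^+ 2 <= _ := unrolled_angle_lipschitz AS BS x0.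
have h2 : - (x * ln x) <= 1 - x := mul_ln_ge x0.
apply: le_trans (ler_wpM2r (ltW x0) chord) _.
rewrite -/x mulrDl; apply: lerD.
  by apply: ler_piMr => //; exact: sqr_ge0.
apply: (@le_trans _ _ (N * M * (alpha ^+ 2 * (- 2 * ln x)) * x)).
  apply: ler_wpM2r; first exact: ltW.
  by apply: ler_wpM2l => //; rewrite mulr_ge0 ?(ltW A0) ?(ltW B0).
have -> : N * M * (alpha ^+ 2 * (- 2 * ln x)) * x =
  2 * alpha ^+ 2 * (N * M) * (- (x * ln x)) by ring.
apply: ler_wpM2l => //.
by rewrite mulr_ge0 ?(mulr_ge0 (ltW A0) (ltW B0))// mulr_ge0 ?sqr_ge0.
Qed.

End AngularDistance.
End Representatives.

Section Matched.
Variables (R : realType) (d : nat) (n k : 'I_d -> nat).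
Hypothesis hk : forall i, (1 <= k i)%N.
Implicit Types (P Q : tensor R n k) (p q : preSV_point R n).

Definition sign_flip (s : {ffun 'I_d -> bool}) p : preSV_point R n :=
  rescale (fun i => (-1) ^+ s i) p.

(** Two representatives have the same radius, and the product of the cosines
   between their factors is 1, so each cosine is 1 or -1. *)
Lemma representatives_sign_flip P p p' :
  representatives P p -> representatives P p' -> exists s, p' = sign_flip s p.
Proof.
move=> [pp pP] [pp' pP'].
have [[p0 p1] [p0' p1']] := (pp, pp').
have pE : p'.1 = p.1.
  by rewrite -(tensor_norm_map k pp) -(tensor_norm_map k pp') pP pP'.
have : \prod_i euclidean_dot (p.2 i) (p'.2 i) ^+ k i = 1.
  rewrite -tensor_cos_map// pP' -pP /tensor_cos -tensor_norm_sqr -expr2.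
  by rewrite divff// expf_neq0// tensor_norm_map// gt_eqF.
pose x i := euclidean_dot (p.2 i) (p'.2 i); rewrite -[LHS]/(\prod_i x i ^+ k i) => x1.
have xle i : `|x i| <= 1 by rewrite ler_norml unit_dot_bounds.
have xn i : `|x i| = 1.
  apply/eqP; rewrite eq_le xle /=.
  have : `|\prod_i x i ^+ k i| <= `|x i|; last by rewrite x1 normr1.
  rewrite (bigD1 i)//= normrM.
  have rest : `|\prod_(j < d | j != i) x j ^+ k j| <= 1.
    elim/big_rec: _ => [|j y _ y1]; first by rewrite normr1.
    by rewrite normrM mulr_ile1// normrX exprn_ile1.
  apply: le_trans (_ : `|x i ^+ k i| <= _); first by rewrite ler_piMr.
  by rewrite normrX -{2}(expr1 `|x i|) ler_wiXn2l// hk.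
exists [ffun i => x i < 0]; rewrite /sign_flip /rescale.
case: p' pE p0' p1' {pp' pP' x1} @x xle xn => l v pE _ v1 x xle xn.
rewrite /= in pE v1 x xle xn *; rewrite pE.
apply: (f_equal (pair p.1)); apply: functional_extensionality_dep => i.
rewrite ffunE.
rewrite [LHS](@unit_dot_sqr1 _ _ (p.2 i) (v i)) ?p1 ?v1//.
  have := xn i; rewrite -/(x i); case: ltP => [x0|x0].
    by rewrite ltr0_norm// => <-; rewrite expr1 opprK.
  by rewrite ger0_norm// => ->; rewrite expr0.
by rewrite -real_normK ?num_real// -/(x i) xn expr1n.
Qed.

Lemma sign_flip_id p : sign_flip [ffun => false] p = p.
Proof.
case: p => l u; rewrite /sign_flip /rescale /=; apply: (f_equal (pair l)).
by apply: functional_extensionality_dep => i; rewrite ffunE expr0 scale1r.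
Qed.

(** The representatives of a tensor are finitely many, so the minimum defining
   a matched pair is attained. *)
Lemma exists_matched P Q : segre_veronese P -> segre_veronese Q ->
  exists p q, matched P Q p q.
Proof.
move=> /segre_veroneseP[p pP] /segre_veroneseP[q qQ].
pose T := ({ffun 'I_d -> bool} * {ffun 'I_d -> bool})%type.
pose ok (s : T) := `[< representatives P (sign_flip s.1 p) /\
  representatives Q (sign_flip s.2 q) >].
pose s0 : T := ([ffun => false], [ffun => false]).
have ok0 : ok s0 by apply/asboolP; rewrite !sign_flip_id.
case: (arg_minP
  (fun s : T => Mdist k (sign_flip s.1 p) (sign_flip s.2 q)) ok0).
move=> s /asboolP[sP sQ] smin.
exists (sign_flip s.1 p), (sign_flip s.2 q); split => // p' q' pP' qQ'.
have [s1 s1E] := representatives_sign_flip pP pP'.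
have [s2 s2E] := representatives_sign_flip qQ qQ'.
have := smin (s1, s2); rewrite /= -s1E -s2E; apply.
by apply/asboolP; rewrite /= -s1E -s2E.
Qed.

End Matched.

(** * Chords and derivatives along a curve *)

Lemma continuous_at_sum (R : realType) (I : finType) (f : I -> R -> R) (t : R) :
  (forall i, {for t, continuous (f i)}) ->
  {for t, continuous (fun z => \sum_i f i z)}.
Proof.
move=> fc; apply: (@cvg_big _ _ +%R 0 predT _ _ _ _
  (fun i z => f i z) (fun i => f i t)).
  exact: add_continuous.
by move=> i _; exact: fc.
Qed.

Section ChordLimit.
Variables (R : realType) (d : nat) (n k : 'I_d -> nat).
Implicit Types (c : R -> tensor R n k) (X : tensor R n k).

Lemma continuous_at_tensor_norm c t :
  (forall J, {for t, continuous (fun z => c z J)}) ->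
  {for t, continuous (fun z => tensor_norm (c z))}.
Proof.
move=> cc; apply: (@continuous_comp _ _ _
  (fun z => tensor_dot (c z) (c z)) (@Num.sqrt R)).
  by apply: continuous_at_sum => J; apply: continuousM; exact: cc.
exact: sqrt_continuous.
Qed.

Lemma continuous_at_tensor_cos c t :
  (forall J, {for t, continuous (fun z => c z J)}) ->
  0 < tensor_norm (c t) ->
  tensor_cos (c t) (c z) @[z --> t] --> (1 : R).
Proof.
move=> cc N0.
have -> : 1 = tensor_cos (c t) (c t).
  by rewrite /tensor_cos -tensor_norm_sqr -expr2 divff// expf_neq0// gt_eqF.
suff : {for t, continuous (fun z =>
    tensor_dot (c t) (c z) / (tensor_norm (c t) * tensor_norm (c z)))} by [].
apply: continuousM.
  apply: continuous_at_sum => J; apply: continuousM; last exact: cc.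
  exact: cst_continuous.
apply: continuousV; first by rewrite mulf_neq0// gt_eqF.
apply: continuousM; first exact: cst_continuous.
exact: continuous_at_tensor_norm.
Qed.

(** Caratheodory's form of the derivative turns the limit of the difference
   quotients of the chord form into the continuity of W. *)
Lemma chord_form_derivative (alpha : R) c X (t : R) :
  (forall J, is_derive t 1 (fun z => c z J) (X J)) -> 0 < tensor_norm (c t) ->
  exists W : R -> R, [/\
    forall z, chord_form alpha (c t) (c z) = W z * (z - t) ^+ 2,
    {for t, continuous W} & W t = warped_metric alpha (c t) X X].
Proof.
move=> dc N0.
have /choice[G GP] : forall J, exists g : R -> R,
    [/\ forall z, c z J - c t J = g z * (z - t), {for t, continuous g} &
        g t = X J].
  by move=> J; apply/is_derive1_caratheodory.
have cc J : {for t, continuous (fun z => c z J)}.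
  exact: is_derive_continuous (dc J).
pose S z := \sum_J G J z ^+ 2.
(* difference of the norms, rationalized as a difference of squares *)
pose r z := (\sum_J G J z * (c z J + c t J)) /
  (tensor_norm (c z) + tensor_norm (c t)).
have Nzt z : 0 < tensor_norm (c z) + tensor_norm (c t).
  by rewrite ltr_wpDl// sqrtr_ge0.
have rP z : tensor_norm (c z) - tensor_norm (c t) = r z * (z - t).
  apply: (mulIf (lt0r_neq0 (Nzt z))).
  rewrite -subr_sqr !tensor_norm_sqr /r mulrAC divfK ?gt_eqF//.
  rewrite mulr_suml -sumrB; apply: eq_bigr => J _.
  have [GJ _ _] := GP J.
  by rewrite mulrAC -GJ; ring.
have SP z : tensor_dot (c t - c z) (c t - c z) = S z * (z - t) ^+ 2.
  rewrite mulr_suml; apply: eq_bigr => J _.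
  have [GJ _ _] := GP J.
  rewrite -exprMn -GJ !ffunE; ring.
exists (fun z => r z ^+ 2 + alpha ^+ 2 * (S z - r z ^+ 2)); split.
- move=> z; rewrite /chord_form SP.
  have -> : (tensor_norm (c t) - tensor_norm (c z)) ^+ 2 = r z ^+ 2 * (z - t) ^+ 2.
    by rewrite -exprMn -rP -opprB sqrrN.
  ring.
- have rc : {for t, continuous r}.
    apply: continuousM.
      apply: continuous_at_sum => J; apply: continuousM; first by case: (GP J).
      by apply: continuousD; [exact: cc|exact: cst_continuous].
    apply: continuousV; first by rewrite gt_eqF.
    by apply: continuousD; [exact: continuous_at_tensor_norm|exact: cst_continuous].
  have rc2 : {for t, continuous (fun z => r z ^+ 2)} by apply: continuousM; exact: rc.
  apply: continuousD => //; apply: continuousM; first exact: cst_continuous.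
  apply: continuousB => //; apply: continuous_at_sum => J.
  by apply: continuousM; case: (GP J).
- rewrite warped_metricE//.
  have -> : r t = tensor_dot X (c t) / tensor_norm (c t).
    rewrite /r -mulr2n -mulr_natl invfM mulrA; congr (_ / _).
    rewrite mulr_suml; apply: eq_bigr => J _.
    by have [_ _ ->] := GP J; field.
  suff -> : S t = tensor_dot X X by [].
  by apply: eq_bigr => J _; have [_ _ ->] := GP J; rewrite expr2.
Qed.

End ChordLimit.

(** Cousin's lemma.  The supremum of the t for which P a t holds can neither
   fail P nor lie below b. *)
Lemma interval_induction (R : realType) (P : R -> R -> Prop) (a b : R) : a <= b ->
  (forall s, a <= s <= b -> P s s) ->
  (forall s t u, a <= s -> s <= t -> t <= u -> u <= b ->
     P s t -> P t u -> P s u) ->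
  (forall T, a <= T <= b -> exists2 e : R, 0 < e &
     (forall t, T < t -> t <= b -> t < T + e -> P T t) /\
     (forall s, a <= s -> s < T -> T - e < s -> P s T)) ->
  P a b.
Proof.
move=> ab P0 PD Ploc.
pose S := [set t | a <= t <= b /\ P a t].
have Sa : S a by split; rewrite ?lexx ?ab//; apply: P0; rewrite lexx.
have supS : has_sup S.
  by split; [exists a|exists b => t [/andP[_ tb] _]].
have aT : a <= sup S by exact: (ub_le_sup supS.2 Sa).
have Tb : sup S <= b by apply: ge_sup; [exists a|move=> t [/andP[_ ?] _]].
have [|e e0 [Pr Pl]] := Ploc (sup S); first by rewrite aT Tb.
have PT : P a (sup S).
  have [t [/andP[at' tb] Pt] tT] := sup_adherent e0 supS.
  have tS : t <= sup S by apply: (ub_le_sup supS.2); split => //; rewrite at' tb.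
  have [->//|tne] := eqVneq (sup S) t.
  by apply: (PD _ t) => //; apply: Pl => //; rewrite lt_neqAle eq_sym tne.
have [->//|Tneb] := eqVneq b (sup S).
have Tltb : sup S < b by rewrite lt_neqAle eq_sym Tneb.
pose u := Num.min b (sup S + e / 2).
have Tu : sup S < u by rewrite lt_min Tltb ltrDl divr_gt0.
have ub : u <= b by rewrite ge_min lexx.
have ue : u < sup S + e by rewrite gt_min; apply/orP; right; lra.
have : u <= sup S.
  apply: (ub_le_sup supS.2); split; first by rewrite ub (le_trans aT (ltW Tu)).
  by apply: (PD _ (sup S)) => //; [exact: ltW|apply: Pr].
by rewrite leNgt Tu.
Qed.

(** * Local Lipschitz bounds and integrals *)

Section LipschitzIntegral.
Variable R : realType.
Local Notation mu := (@lebesgue_measure R).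

Lemma integral_itv_split (f : R -> R) (s t u : R) : s <= t -> t <= u ->
  measurable_fun `[s, u] f ->
  (\int[mu]_(x in `[s, u]) (f x)%:E =
   \int[mu]_(x in `[s, t]) (f x)%:E + \int[mu]_(x in `[t, u]) (f x)%:E)%E.
Proof.
move=> st tu /measurable_EFinP mf.
have tuS : `]t, u] `<=` `[s, u] by apply: subset_itvr; rewrite bnd_simp.
rewrite (@itv_bndbnd_setU _ _ _ (BRight t)) ?bnd_simp//.
rewrite integral_setU//=.
- rewrite integral_itv_obnd_cbnd//; exact: measurable_funS mf.
- by rewrite -itv_bndbnd_setU ?bnd_simp.
- apply/disj_setPLR => x/=; rewrite !in_itv/= => /andP[_ xt] /andP[].
  by rewrite ltNge xt.
Qed.

Lemma integral_itv_ge_cst (f : R -> R) (r s t : R) : s <= t ->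
  measurable_fun `[s, t] f -> (forall x, s <= x <= t -> 0 <= f x) ->
  (forall x, s <= x <= t -> r <= f x) ->
  ((r * (t - s))%:E <= \int[mu]_(x in `[s, t]) (f x)%:E)%E.
Proof.
move=> st mf f0 rf.
have [r0|r0] := leP r 0.
  apply: (@le_trans _ _ 0%E).
    by rewrite lee_fin mulr_le0_ge0// subr_ge0.
  by apply: integral_ge0 => x /=; rewrite in_itv/= lee_fin; exact: f0.
have <- : (\int[mu]_(x in `[s, t]) r%:E = (r * (t - s))%:E)%E.
  rewrite integral_cst//= lebesgue_measure_itv/= lte_fin.
  case: ltP => [_|ts]; first by rewrite -EFinB -EFinM.
  by rewrite (le_anti (introT andP (conj st ts))) subrr mulr0 mule0.
apply: ge0_le_integral => //=.
- by move=> x _; rewrite lee_fin ltW.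
- by apply/measurable_EFinP.
Qed.

(** By continuity, the integral of f over a short interval at T is at least
   f T - h per unit of length, which absorbs the local bound f T + h up to 2 h
   per unit of length; both sides are additive in the interval. *)
Lemma local_lipschitz_integral (f g : R -> R) (a b : R) : a <= b ->
  (forall t, 0 <= f t) ->
  {in `[a, b], forall t, {for t, continuous f}} ->
  (forall T e : R, a <= T <= b -> 0 < e -> \forall t \near T,
     a <= t <= b -> `|g t - g T| <= (f T + e) * `|t - T|) ->
  (`|g b - g a|%:E <= \int[mu]_(x in `[a, b]) (f x)%:E)%E.
Proof.
move=> ab f0 fc gloc.
have mf : measurable_fun `[a, b] f.
  apply: subspace_continuous_measurable_fun => //.
  by apply: continuous_in_subspaceT => x; rewrite inE; exact: fc.
have mfS s t : a <= s -> t <= b -> measurable_fun `[s, t] f.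
  move=> as_ tb; apply: measurable_funS mf => //.
  by apply: subset_itv; rewrite bnd_simp.
apply/lee_addgt0Pr => _ /posnumP[e].
pose h := e%:num / (2 * (b - a + 1)).
have ba : 0 < b - a + 1 by rewrite ltr_wpDl ?subr_ge0.
have h0 : 0 < h by rewrite divr_gt0// mulr_gt0.
pose P s t := (`|g t - g s|%:E <=
  \int[mu]_(x in `[s, t]) (f x)%:E + (2 * h * (t - s))%:E)%E.
suff : P a b.
  move=> Pab; apply: (le_trans Pab); apply: leeD2l; rewrite lee_fin.
  have -> : 2 * h * (b - a) = e%:num * ((b - a) / (b - a + 1)).
    by rewrite /h; field; rewrite gt_eqF.
  by rewrite ler_piMr// ler_pdivrMr// mul1r lerDl.
apply: (@interval_induction R P a b ab).
- move=> s _; rewrite /P !subrr normr0 mulr0 adde0.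
  by apply: integral_ge0 => x _; rewrite lee_fin f0.
- move=> s t u as_ st tu ub; rewrite /P => Pst Ptu.
  rewrite (@integral_itv_split _ s t u)//; last exact: mfS.
  have -> : 2 * h * (u - s) = 2 * h * (t - s) + 2 * h * (u - t) by ring.
  rewrite EFinD addeACA; apply: le_trans (leeD Pst Ptu).
  by rewrite -EFinD lee_fin (addrC `|g t - g s|) ler_distD.
- move=> T Tab.
  have fT : \forall t \near T, f T - h <= f t.
    have /cvgrPdist_le/(_ h h0) := fc T Tab.
    by apply: filterS => t; rewrite ler_norml => /andP[_]; lra.
  have [e1 /= e10 He1] := filterI (gloc T h Tab h0) fT.
  have close s t : a <= s -> s <= t -> t <= b -> (s = T \/ t = T) ->
      t - s < e1 -> P s t.
    move=> as_ st tb sT ts; rewrite /P.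
    have lo : (((f T - h) * (t - s))%:E <= \int[mu]_(x in `[s, t]) (f x)%:E)%E.
      apply: integral_itv_ge_cst => //; first exact: mfS.
      move=> x /andP[sx xt]; apply: (He1 x _).2.
      rewrite /ball_/= ltr_norml; case: sT => <-; apply/andP; split; lra.
    apply: le_trans (leeD2r _ lo); rewrite -EFinD lee_fin.
    have -> : (f T - h) * (t - s) + 2 * h * (t - s) = (f T + h) * (t - s) by ring.
    have dist : `|t - s| = t - s by rewrite ger0_norm ?subr_ge0.
    case: sT => TE.
      have := (He1 t _).1; rewrite -TE dist; apply; last by rewrite tb (le_trans as_).
      by rewrite /ball_/= distrC dist.
    have := (He1 s _).1; rewrite -TE distrC (distrC s) dist; apply.
      by rewrite /ball_/= dist.
    by rewrite as_ (le_trans st).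
  case/andP: Tab => aT Tb.
  exists e1 => //; split=> [t Tt tb te|s as_ sT se].
    by apply: close => //; [exact: ltW|left|lra].
  by apply: close => //; [exact: ltW|right|lra].
Qed.

End LipschitzIntegral.

(** * Speed of piecewise smooth curves *)

Section SmoothFunctions.
Variable R : realType.
Implicit Types f : R -> R.

Lemma smooth_derivable f t : smooth f -> derivable f t 1.
Proof. by move=> /(_ 0%N). Qed.

Lemma smooth_derive1 f : smooth f -> smooth (derive1 f).
Proof. by move=> fs m t; have := fs m.+1 t; rewrite /derive1n iterSr. Qed.

Lemma smooth_continuous f t : smooth f -> {for t, continuous f}.
Proof.
by move=> /smooth_derivable h; apply/differentiable_continuous/derivable1_diffP.
Qed.

End SmoothFunctions.

Section CurveSpeed.
Variables (R : realType) (d : nat) (n k : 'I_d -> nat) (alpha : R).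
Local Notation mu := (@lebesgue_measure R).
Implicit Types (c F : R -> tensor R n k) (g : R -> R).

Definition speed c (t : R) : R :=
  Num.sqrt (warped_metric alpha (c t) (velocity c t) (velocity c t)).

Definition smooth_curve F := forall J, smooth (fun t => F t J).

Lemma smooth_on_curve a b c : smooth_on a b c ->
  exists2 F, smooth_curve F & {in `[a, b], c =1 F}.
Proof.
move=> cs; have /choice[f fP] : forall J, exists f : R -> R,
    smooth f /\ {in `[a, b], forall t, c t J = f t}.
  by move=> J; have [f] := cs J; exists f.
exists (fun t => [ffun J => f J t]) => [J|t tab].
  rewrite (_ : (fun t => _) = f J); first by case: (fP J).
  by apply/funext => t; rewrite ffunE.
by apply/ffunP => J; rewrite ffunE; apply: (fP J).2.
Qed.

Lemma is_derive_velocity F (t : R) J : smooth_curve F ->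
  is_derive t 1 (fun z => F z J) (velocity F t J).
Proof.
by move=> Fs; rewrite ffunE derive1E; apply: derivableP; exact: smooth_derivable.
Qed.

Lemma speed_continuous F t : smooth_curve F -> 0 < tensor_norm (F t) ->
  {for t, continuous (speed F)}.
Proof.
move=> Fs N0.
have Fc J : {for t, continuous (fun z => F z J)} by exact: smooth_continuous.
have Vc J : {for t, continuous (fun z => velocity F z J)}.
  have -> : (fun z => velocity F z J) = derive1 (fun z => F z J).
    by apply/funext => z; rewrite ffunE.
  by apply: smooth_continuous; exact: smooth_derive1.
have Nc := continuous_at_tensor_norm Fc.
apply: (@continuous_comp _ _ _
  (fun t => warped_metric alpha (F t) (velocity F t) (velocity F t)) (@Num.sqrt R));
  last exact: sqrt_continuous.
pose r z := tensor_dot (velocity F z) (F z) / tensor_norm (F z).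
have rc : {for t, continuous r}.
  apply: continuousM; last by apply: continuousV => //; rewrite gt_eqF.
  by apply: continuous_at_sum => J; apply: continuousM; [exact: Vc|exact: Fc].
have r2c : {for t, continuous (fun z => r z ^+ 2)} by apply: continuousM; exact: rc.
have wc : {for t, continuous (fun z => r z ^+ 2 +
    alpha ^+ 2 * (tensor_dot (velocity F z) (velocity F z) - r z ^+ 2))}.
  apply: continuousD => //; apply: continuousM; first exact: cst_continuous.
  apply: continuousB => //; apply: continuous_at_sum => J.
  by apply: continuousM; exact: Vc.
rewrite /prop_for /continuous_at warped_metricE//.
apply: cvg_trans wc; apply: near_eq_cvg.
have : \forall z \near t, 0 < tensor_norm (F z) by apply: cvgr_gt (Nc) _ N0.
by apply: filterS => z Nz; rewrite warped_metricE.
Qed.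

Lemma velocity_eq_in a b c F x : {in `[a, b], c =1 F} -> x \in `]a, b[ ->
  velocity c x = velocity F x.
Proof.
move=> cF xab; apply/ffunP => J; rewrite !ffunE !derive1E.
apply: near_eq_derive; apply: filterS (near_in_itvoo xab) => z zab.
by rewrite cF//; exact: subset_itv_oo_cc zab.
Qed.

Lemma speed_eq_in a b c F : {in `[a, b], c =1 F} -> {in `]a, b[, speed c =1 speed F}.
Proof.
move=> cF x xab; rewrite /speed (velocity_eq_in cF xab) cF//.
exact: subset_itv_oo_cc xab.
Qed.

Lemma smooth_curve_measurable_speed F a b : smooth_curve F ->
  (forall t, a <= t <= b -> 0 < tensor_norm (F t)) ->
  measurable_fun `[a, b] (speed F).
Proof.
move=> Fs N0; apply: subspace_continuous_measurable_fun => //.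
apply: continuous_in_subspaceT => x; rewrite inE/= in_itv/= => /N0.
exact: speed_continuous.
Qed.

Lemma smooth_on_measurable_speed a b c : smooth_on a b c ->
  (forall t, a <= t <= b -> 0 < tensor_norm (c t)) ->
  measurable_fun `[a, b] (speed c).
Proof.
move=> /smooth_on_curve[F Fs cF] N0.
have mF : measurable_fun `[a, b] (speed F).
  apply: smooth_curve_measurable_speed => // t tab.
  by rewrite -(cF t tab); exact: N0.
apply: (@measurable_fun_itv_cc _ _ _ false true).
apply: (@eq_measurable_fun _ _ _ _ _ (speed F)).
  by move=> x; rewrite inE => xab; rewrite (speed_eq_in cF).
by apply: measurable_funS mF => //; exact: subset_itv_oo_cc.
Qed.

(** Along a smooth curve the cosine tends to 1 and the chord form, divided by
   (s - t) ^ 2, to the squared speed: g has the speed as local Lipschitz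
   constant. *)
Definition chord_controlled c (a b : R) g := forall s t, a <= s <= b -> a <= t <= b ->
  0 < tensor_cos (c s) (c t) ->
  (g s - g t) ^+ 2 * tensor_cos (c s) (c t) <= chord_form alpha (c s) (c t).

Lemma smooth_curve_variation F a b g : a <= b -> smooth_curve F ->
  (forall t, a <= t <= b -> 0 < tensor_norm (F t)) ->
  chord_controlled F a b g ->
  (`|g b - g a|%:E <= \int[mu]_(x in `[a, b]) (speed F x)%:E)%E.
Proof.
move=> ab Fs N0 gF; apply: local_lipschitz_integral => //.
- by move=> t; exact: sqrtr_ge0.
- by move=> t; rewrite in_itv/= => /N0; exact: speed_continuous.
- move=> T e Tab e0.
  have [W [WE Wc WT]] := chord_form_derivative alpha
    (fun J => is_derive_velocity T J Fs) (N0 _ Tab).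
  have x1 : tensor_cos (F T) (F T) = 1.
    by rewrite /tensor_cos -tensor_norm_sqr -expr2 divff// expf_neq0// gt_eqF ?N0.
  have xc : {for T, continuous (fun z => tensor_cos (F T) (F z))}.
    have Fc J : {for T, continuous (fun z => F z J)} by exact: smooth_continuous.
    by rewrite /prop_for /continuous_at x1; apply: continuous_at_tensor_cos (N0 _ Tab).
  have s0 : 0 <= speed F T by exact: sqrtr_ge0.
  pose h z := (speed F T + e) ^+ 2 * tensor_cos (F T) (F z) - W z.
  have hc : {for T, continuous h}.
    by apply: continuousB => //; apply: continuousM => //; exact: cst_continuous.
  have hT : 0 < h T.
    rewrite /h x1 mulr1 WT -(sqr_sqrtr (warped_metric_ge0 _ _ _)) -/(speed F T).
    by rewrite subr_gt0 ltr_pXn2r ?nnegrE ?addr_ge0 ?(ltW e0)// ltrDl.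
  have near_h : \forall t \near T, 0 < h t by apply: cvgr_gt hc _ hT.
  have near_x : \forall t \near T, 0 < tensor_cos (F T) (F t).
    by apply: cvgr_gt xc _ _; rewrite x1.
  apply: filterS2 near_h near_x => t ht xt tab.
  have := gF T t Tab tab xt; rewrite WE => gt.
  rewrite -ler_sqr ?nnegrE ?mulr_ge0 ?addr_ge0 ?(ltW e0)//.
  rewrite real_normK ?num_real// exprMn real_normK ?num_real//.
  rewrite -(ler_pM2r xt) -[g t - _]opprB sqrrN; apply: (le_trans gt).
  rewrite mulrAC ler_wpM2r ?sqr_ge0//.
  by move: ht; rewrite subr_gt0 => /ltW.
Qed.

Lemma smooth_on_variation a b c g : a <= b -> smooth_on a b c ->
  (forall t, a <= t <= b -> 0 < tensor_norm (c t)) ->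
  chord_controlled c a b g ->
  (`|g b - g a|%:E <= \int[mu]_(x in `[a, b]) (speed c x)%:E)%E.
Proof.
move=> ab /[dup] cs /smooth_on_curve[F Fs cF] N0 gc.
have cE t : a <= t <= b -> F t = c t by move=> tab; rewrite cF ?in_itv.
have FN0 t : a <= t <= b -> 0 < tensor_norm (F t) by move=> tab; rewrite cE ?N0.
have oo : `]a, b[ `<=` `[a, b] by exact: subset_itv_oo_cc.
have -> : (\int[mu]_(x in `[a, b]) (speed c x)%:E =
           \int[mu]_(x in `[a, b]) (speed F x)%:E)%E.
  apply: eq_integral_itv_bounded; last exact: speed_eq_in.
  - by apply: measurable_funS (smooth_on_measurable_speed cs N0).
  - by apply: measurable_funS (smooth_curve_measurable_speed Fs FN0).
apply: smooth_curve_variation => // s t sab tab; rewrite !cE//.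
exact: gc.
Qed.

Lemma piecewise_smooth_ind (P : R -> R -> Prop) a b c :
  (forall s, P s s) ->
  (forall s t u, a <= s -> s <= t -> t <= u -> u <= b ->
     P s t -> P t u -> P s u) ->
  (forall s t, a <= s -> s < t -> t <= b -> smooth_on s t c -> P s t) ->
  piecewise_smooth a b c -> P a b.
Proof.
move=> P0 PD Ps [s]; elim: s a PD Ps => [|x s IH] a PD Ps ab_s pw.
  by rewrite (itv_partition_nil ab_s).
have ax : a < x by case: ab_s => /= /andP[].
have xb_s := itv_partition_cons ab_s.
have xb := itv_partition_le xb_s.
apply: (PD a x b) => //; first exact: ltW.
- by apply: Ps => //; exact: (pw 0%N isT).
- apply: IH => //.
  + move=> u v w xu; apply: PD; exact: le_trans (ltW ax) xu.
  + move=> u v xu; apply: Ps; exact: le_trans (ltW ax) xu.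
  + by move=> i si; exact: (pw i.+1).
Qed.

Lemma smooth_on_subset a b s t c : a <= s -> t <= b -> smooth_on a b c ->
  smooth_on s t c.
Proof.
move=> as_ tb cs J; have [f fs cf] := cs J; exists f => // x.
rewrite in_itv/= => /andP[sx xt]; apply: cf; rewrite in_itv/=.
by rewrite (le_trans as_ sx) (le_trans xt tb).
Qed.

Section PiecewiseSmooth.
Variables (a b : R) (c : R -> tensor R n k).
Hypothesis cpw : piecewise_smooth a b c.
Hypothesis N0 : forall t, a <= t <= b -> 0 < tensor_norm (c t).

Lemma piecewise_smooth_measurable_speed : measurable_fun `[a, b] (speed c).
Proof.
apply: (@piecewise_smooth_ind (fun s t => measurable_fun `[s, t] (speed c)) a b c
  _ _ _ cpw) =>
  [s|s t u _ st tu _ mst mtu|s t as_ _ tb cs].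
- by rewrite set_itv1; exact: measurable_fun_set1.
- rewrite (@itv_bndbnd_setU _ _ _ (BRight t)) ?bnd_simp//.
  apply/measurable_funU => //; split => //.
  apply: measurable_funS mtu => //; exact: subset_itv_oc_cc.
- apply: smooth_on_measurable_speed => // x /andP[sx xt]; apply: N0.
  by rewrite (le_trans as_ sx) (le_trans xt tb).
Qed.

Lemma piecewise_smooth_variation g x y : a <= x -> x <= y -> y <= b ->
  chord_controlled c a b g ->
  (`|g y - g x|%:E <= \int[mu]_(z in `[x, y]) (speed c z)%:E)%E.
Proof.
move=> ax xy yb gc.
pose P s t := forall x y, s <= x -> x <= y -> y <= t ->
  (`|g y - g x|%:E <= \int[mu]_(z in `[x, y]) (speed c z)%:E)%E.
suff : P a b by apply.
apply: (@piecewise_smooth_ind P a b c _ _ _ cpw) =>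
  [s|s t u as_ st tu ub Pst Ptu|s t as_ st tb cs];
  move=> {ax xy yb} {}x {}y sx xy yt.
- have -> : x = y by apply/le_anti; rewrite xy (le_trans yt sx).
  by rewrite subrr normr0; apply: integral_ge0 => z _; rewrite lee_fin sqrtr_ge0.
- have [yt'|ty] := leP y t; first exact: Pst.
  have [tx|xt] := leP t x; first exact: Ptu.
  rewrite (@integral_itv_split _ _ x t y) ?(ltW xt) ?(ltW ty)//; last first.
    apply: measurable_funS piecewise_smooth_measurable_speed => //.
    by apply: subset_itv; rewrite bnd_simp; [exact: le_trans sx|exact: le_trans ub].
  apply: le_trans (leeD (Pst x t _ _ _) (Ptu t y _ _ _)) => //; try exact: ltW.
  by rewrite -EFinD lee_fin (addrC `|g t - g x|) ler_distD.
- have sub z : x <= z <= y -> a <= z <= b.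
    move=> /andP[xz zy]; rewrite (le_trans as_)/=; last exact: le_trans sx xz.
    exact: le_trans zy (le_trans yt tb).
  apply: smooth_on_variation => //; first exact: smooth_on_subset cs.
    by move=> z /sub; exact: N0.
  by move=> u v /sub uab /sub vab; exact: gc.
Qed.

End PiecewiseSmooth.
End CurveSpeed.

(** * Lower bounds for lengths *)

Section LowerBound.
Variables (R : realType) (d : nat) (n k : 'I_d -> nat).
Hypothesis hn : forall i, (2 <= n i)%N.
Hypothesis hk : forall i, (1 <= k i)%N.
Variables (alpha beta : R).
Hypothesis alpha0 : 0 < alpha.
Variables (P Q : tensor R n k) (p : preSV_point R n).
Hypothesis pP : representatives P p.
Hypothesis beta0 : 0 <= beta.
Hypothesis beta_le : forall q, representatives Q q -> beta <= alpha * Mdist k p q.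
Variables (a b : R) (c : R -> tensor R n k).
Hypothesis cPQ : connecting_curve P Q a b c.
Local Notation mu := (@lebesgue_measure R).
Local Notation phi := (unrolled_angle p alpha beta).
Local Notation coord := (unrolled_coordinate p alpha beta).

Let ab : a < b. Proof. by case: cPQ. Qed.
Let cpw : piecewise_smooth a b c. Proof. by case: cPQ. Qed.
Let cS t : a <= t <= b -> segre_veronese (c t).
Proof. by case: cPQ => _ _ h _ _ tab; apply: h; rewrite in_itv. Qed.
Let ca : c a = P. Proof. by case: cPQ. Qed.
Let cb : c b = Q. Proof. by case: cPQ. Qed.
Let cN t : a <= t <= b -> 0 < tensor_norm (c t).
Proof. by move=> /cS; exact: segre_veronese_norm_gt0. Qed.
Let aab : a <= a <= b. Proof. by rewrite lexx ltW. Qed.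
Let bab : a <= b <= b. Proof. by rewrite lexx ltW. Qed.

Lemma unrolled_angle_start : phi P = 0.
Proof.
by case: pP => pp <-; rewrite /unrolled_angle angular_distancep// mulr0 min_l.
Qed.

Lemma unrolled_angle_end : phi Q = beta.
Proof.
rewrite /unrolled_angle min_r// mulrC -ler_pdivrMr//.
apply: angular_distance_ge; first by rewrite -cb; exact: cS.
by move=> q /beta_le; rewrite ler_pdivrMr// mulrC.
Qed.

Lemma unrolled_coordinate_variation (e1 e2 x y : R) : e1 ^+ 2 + e2 ^+ 2 = 1 ->
  a <= x -> x <= y -> y <= b ->
  (`|coord e1 e2 (c y) - coord e1 e2 (c x)|%:E <=
   \int[mu]_(z in `[x, y]) (speed alpha c z)%:E)%E.
Proof.
move=> e1e2 ax xy yb.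
apply: (@piecewise_smooth_variation _ _ _ _ alpha a b c cpw cN
  (fun t => coord e1 e2 (c t))) => // s t sab tab x0.
by apply: unrolled_chord => //; [case: pP|exact: cS|exact: cS].
Qed.

Lemma curve_length_ge (e1 e2 : R) : e1 ^+ 2 + e2 ^+ 2 = 1 ->
  (`|tensor_norm Q * (e1 * cos beta + e2 * sin beta) - tensor_norm P * e1|%:E <=
   curve_length alpha a b c)%E.
Proof.
move=> e1e2; have := unrolled_coordinate_variation e1e2 (lexx a) (ltW ab) (lexx b).
rewrite ca cb /unrolled_coordinate unrolled_angle_start unrolled_angle_end.
by rewrite cos0 sin0 mulr1 mulr0 addr0.
Qed.

Lemma unrolled_angle_continuous :
  {within `[a, b], continuous (fun t => phi (c t))}.
Proof.
apply: (@piecewise_smooth_ind _ _ _ _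
  (fun s t => {within `[s, t], continuous (fun t => phi (c t))}) a b c _ _ _ cpw).
- move=> s; rewrite set_itv1; exact: continuous_subspace1.
- move=> s t u _ st tu _ ist itu.
  rewrite (_ : `[s, u]%classic = `[s, t] `|` `[t, u]).
    by apply: withinU_continuous => //; exact: interval_closed.
  apply/seteqP; split => x /=; rewrite !in_itv/=.
    by case: (leP x t) => [xt /andP[-> _]|tx /andP[_ ->]]; [left|right; rewrite ltW].
  by case=> /andP[h1 h2]; [rewrite h1 (le_trans h2)|rewrite h2 (le_trans st)].
- move=> s t as_ st tb /smooth_on_curve[F Fs cF].
  apply/subspace_continuousP => T Tst.
  have sub z : z \in `[s, t] -> a <= z <= b.
    by rewrite in_itv/= => /andP[sz zt]; rewrite (le_trans as_) ?(le_trans zt).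
  have FT0 : 0 < tensor_norm (F T) by rewrite -cF//; apply: cN; exact: sub.
  have Fc J : {for T, continuous (fun z => F z J)} by exact: smooth_continuous.
  have xc := continuous_at_tensor_cos Fc FT0.
  pose h z := alpha ^+ 2 * (- 2 * ln (tensor_cos (F T) (F z))).
  have hc : h z @[z --> T] --> 0.
    have -> : 0 = alpha ^+ 2 * (- 2 * ln 1) :> R by rewrite ln1 !mulr0.
    apply: cvgMr; apply: cvgMr; apply: (cvg_comp _ _ xc).
    by apply: continuous_ln; exact: ltr01.
  apply/cvgrPdist_lt => e e0; rewrite near_withinE.
  have near_x : \forall z \near T, 0 < tensor_cos (F T) (F z).
    by apply: cvgr_gt xc _ _.
  have near_h : \forall z \near T, h z < e ^+ 2.
    by apply: cvgr_lt hc _ _; rewrite exprn_gt0.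
  apply: filterS2 near_x near_h => z x0 hz zst.
  rewrite -ltr_sqr ?nnegrE ?(ltW e0)// real_normK ?num_real//.
  apply: le_lt_trans hz; rewrite /h -!cF//.
  apply: unrolled_angle_lipschitz => //; first by case: pP.
  - by apply: cS; exact: sub.
  - by apply: cS; exact: sub.
  - by rewrite !cF.
Qed.

(** A curve of total unrolled angle pi crosses the angle pi / 2, at a positive
   distance from the apex: the two legs of the broken line through that point
   are hypotenuses longer than the radii of P and Q. *)
Lemma curve_length_gt : beta = pi ->
  ((tensor_norm P + tensor_norm Q)%:E < curve_length alpha a b c)%E.
Proof.
move=> bpi.
have [|t tab phit] := @IVT R (fun t => phi (c t)) a b (pi / 2) (ltW ab)
  unrolled_angle_continuous.
  rewrite ca cb unrolled_angle_start unrolled_angle_end bpi.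
  have := pi_gt0 R; rewrite /Num.min /Num.max => pi0; rewrite pi0.
  by apply/andP; split; lra.
move: (tab); rewrite in_itv/= => tab'; have /andP[at' tb] := tab'.
set r := tensor_norm (c t); have r0 : 0 < r by exact: cN.
(* the unit vector from the point N on one axis to the point r on the other *)
have leg (N : R) : 0 < N -> exists e : R * R, [/\ e.1 ^+ 2 + e.2 ^+ 2 = 1 &
    N < `|r * e.2 - N * e.1| ].
  move=> NN; pose D := Num.sqrt (N ^+ 2 + r ^+ 2).
  have DD : D ^+ 2 = N ^+ 2 + r ^+ 2 by rewrite sqr_sqrtr// addr_ge0 ?sqr_ge0.
  have D0 : 0 < D by rewrite sqrtr_gt0 addr_gt0 ?exprn_gt0.
  exists (- N / D, r / D); split=> /=.
    rewrite !expr_div_n sqrrN -mulrDl -DD divff//.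
    by rewrite expf_neq0// gt_eqF.
  have -> : r * (r / D) - N * (- N / D) = D.
    apply: (mulIf (lt0r_neq0 D0)); rewrite -expr2 DD; field.
    by rewrite gt_eqF.
  rewrite ger0_norm ?(ltW D0)// -ltr_sqr ?nnegrE ?(ltW NN) ?(ltW D0)// DD.
  by rewrite ltrDl exprn_gt0.
have NP : 0 < tensor_norm P by rewrite -ca; exact: cN.
have NQ : 0 < tensor_norm Q by rewrite -cb; exact: cN.
have [[e1 e2] [/= e12 lP]] := leg _ NP.
have [[f1 f2] [/= f12 lQ]] := leg _ NQ.
have f12' : (- f1) ^+ 2 + f2 ^+ 2 = 1 by rewrite sqrrN.
have hP := unrolled_coordinate_variation e12 (lexx a) at' tb.
have hQ := unrolled_coordinate_variation f12' at' tb (lexx b).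
rewrite /curve_length -/(speed alpha c) (@integral_itv_split _ _ a t b)//; last first.
  exact: piecewise_smooth_measurable_speed.
rewrite EFinD; apply: lteD.
  apply: lt_le_trans hP; rewrite lte_fin ca /unrolled_coordinate phit.
  rewrite unrolled_angle_start cos_pihalf sin_pihalf cos0 sin0.
  by rewrite !mulr0 !mulr1 add0r addr0.
apply: lt_le_trans hQ; rewrite lte_fin cb /unrolled_coordinate phit.
rewrite unrolled_angle_end bpi cos_pihalf sin_pihalf cospi sinpi distrC.
by rewrite !mulr0 mulrNN !mulr1 add0r addr0.
Qed.

End LowerBound.

(** * Smoothness and speed of sweeping curves *)

Section GeneratedFunctions.
Variable R : realType.
Implicit Types f g : R -> R.

(** An algebra of functions generated by functions whose derivatives lie in it
   again consists of smooth functions. *)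
Inductive generated (G : (R -> R) -> Prop) : (R -> R) -> Prop :=
| generated_base f : G f -> generated G f
| generated_cst a : generated G (fun=> a)
| generated_add f g : generated G f -> generated G g ->
    generated G (fun t => f t + g t)
| generated_mul f g : generated G f -> generated G g ->
    generated G (fun t => f t * g t).

Lemma generated_prod G (I : Type) (r : seq I) (F : I -> R -> R) :
  (forall i, generated G (F i)) -> generated G (fun t => \prod_(i <- r) F i t).
Proof.
move=> FG; elim: r => [|i r IH].
  by under eq_fun do rewrite big_nil; exact: generated_cst.
by under eq_fun do rewrite big_cons; exact: generated_mul.
Qed.

Lemma generated_smooth G :
  (forall f, G f ->
     exists2 df, generated G df & forall t : R, is_derive t 1 f (df t)) ->
  forall f, generated G f -> smooth f.
Proof.
move=> Gd.
have step f : generated G f ->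
    exists2 df, generated G df & forall t : R, is_derive t 1 f (df t).
  elim=> [{}f /Gd//|a|{}f g fG [df dfG dfP] gG [dg dgG dgP]|
    {}f g fG [df dfG dfP] gG [dg dgG dgP]].
  - by exists (fun=> 0); [exact: generated_cst|move=> t; exact: is_derive_cst].
  - exists (fun t => df t + dg t); first exact: generated_add.
    by move=> t; exact: is_deriveD.
  - exists (fun t => f t * dg t + g t * df t); last by move=> t; exact: is_deriveM.
    by apply: generated_add; apply: generated_mul.
move=> f fG m; elim: m f fG => [|m IH] f /step[df dfG dfP] t.
  by have [] := dfP t.
rewrite /derive1n iterSr; have -> : derive1 f = df; last exact: IH.
by apply/funext => x; rewrite derive1E derive_val.
Qed.

(** The derivative of atan is the square of cos (atan t), so that these
   generators satisfy the hypothesis of [generated_smooth]. *)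
Definition atan_wave f :=
  f = id \/ exists w v : R, f = fun t => cos (w * atan t + v).

Lemma cos_atan_sqr (t : R) : cos (atan t) ^+ 2 = (1 + t ^+ 2)^-1.
Proof. by rewrite cos_atan exprVn sqr_sqrtr// addr_ge0// sqr_ge0. Qed.

Lemma sin_atan (t : R) : sin (atan t) = t * cos (atan t).
Proof.
have c0 : cos (atan t) != 0.
  by rewrite gt_eqF// cos_gt0_pihalf// atan_gtNpi2 atan_ltpi2.
by rewrite -{2}(atanK t) /tan divfK.
Qed.

Lemma is_derive_atan (t : R) : is_derive t 1 (@atan R) (1 + t ^+ 2)^-1.
Proof.
have -> : (1 + t ^+ 2)^-1 = 'D_1 (@atan R) t by rewrite -derive1E derive1_atan.
by apply: derivableP; exact: derivable_atan.
Qed.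

Lemma atan_wave_smooth f : generated atan_wave f -> smooth f.
Proof.
apply: generated_smooth => {}f [->|[w [v ->]]].
  by exists (fun=> 1); [exact: generated_cst|move=> t; exact: is_derive_id].
exists (fun t => w * cos (w * atan t + (v + pi / 2)) *
  (cos (1 * atan t + 0) * cos (1 * atan t + 0))).
  apply: generated_mul; last by apply: generated_mul; apply: generated_base; right;
    exists 1, 0.
  apply: generated_mul; first exact: generated_cst.
  by apply: generated_base; right; exists w, (v + pi / 2).
move=> t; have dat := is_derive_atan t.
rewrite addrA cosDpihalf mul1r addr0 -expr2 cos_atan_sqr.
apply: is_derive_eq; rewrite /GRing.scale/=; ring.
Qed.

Lemma generated_cos (w v : R) :
  generated atan_wave (fun t => cos (w * (atan t + v))).
Proof.
apply: generated_base; right; exists w, (w * v).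
by apply/funext => t; rewrite mulrDr.
Qed.

Lemma generated_sin (w v : R) :
  generated atan_wave (fun t => sin (w * (atan t + v))).
Proof.
apply: generated_base; right; exists w, (w * v - pi / 2).
by apply/funext => t; rewrite addrA cosBpihalf mulrDr.
Qed.

End GeneratedFunctions.

Section Sweep.
Variables (R : realType) (d : nat) (n k : 'I_d -> nat) (alpha : R).
Hypothesis hn : forall i, (2 <= n i)%N.
Variables (p q : preSV_point R n).
Hypotheses (pp : preSV p) (qq : preSV q).
Local Notation mu := (@lebesgue_measure R).
Local Notation theta i := (sphere_angle (p.2 i) (q.2 i)).

Definition sweep (w : forall i, 'rV[R]_(n i)) (rho s : R) : preSV_point R n :=
  (rho, fun i => cos (theta i * s) *: p.2 i + sin (theta i * s) *: w i).

Variable w : forall i, 'rV[R]_(n i).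
Hypothesis ww : forall i, euclidean_dot (w i) (w i) = 1.
Hypothesis pw : forall i, euclidean_dot (p.2 i) (w i) = 0.
Hypothesis qE : forall i, q.2 i = cos (theta i) *: p.2 i + sin (theta i) *: w i.

Lemma sweep_dot rho rho' s s' i :
  euclidean_dot ((sweep w rho s).2 i) ((sweep w rho' s').2 i) = cos (theta i * (s - s')).
Proof.
rewrite /= !(euclidean_dotDl, euclidean_dotDr, euclidean_dotZl, euclidean_dotZr).
rewrite ww pw (euclidean_dotC (w i)) pw pp.2 mulrBr cosB; ring.
Qed.

Lemma preSV_sweep rho s : 0 < rho -> preSV (sweep w rho s).
Proof. by move=> r0; split => // i; rewrite sweep_dot subrr mulr0 cos0. Qed.

(** The cosine of the angle between the tensors is a product of cosines, to
   which 1 - cos t <= t ^ 2 / 2 applies factor by factor. *)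
Lemma sweep_chord rho rho' s s' : 0 < rho -> 0 < rho' ->
  chord_form alpha (tensor_map k (sweep w rho s)) (tensor_map k (sweep w rho' s')) <=
  (rho - rho') ^+ 2 +
  alpha ^+ 2 * (rho * rho') * (Mdist k p q ^+ 2 * (s - s') ^+ 2).
Proof.
move=> r0 r0'; have [h h'] := (preSV_sweep s r0, preSV_sweep s' r0').
rewrite chord_formE ?tensor_norm_map// tensor_cos_map// lerD2l.
under eq_bigr do rewrite sweep_dot.
rewrite [leLHS](_ : _ = alpha ^+ 2 * (rho * rho') *
  (2 * (1 - \prod_i cos (theta i * (s - s')) ^+ k i))); last by rewrite /=; ring.
apply: ler_wpM2l; first by rewrite (mulr_ge0 (sqr_ge0 _))// (mulr_ge0 (ltW r0) (ltW r0')).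
rewrite Mdist_sqr -ler_pdivlMl// mulr_suml mulr_sumr.
apply: le_trans (one_sub_prod_le _ _ _) _.
  by move=> i; rewrite normrX; apply: exprn_ile1 => //; exact: cos_max.
apply: ler_sum => i _; set x := cos _.
apply: (@le_trans _ _ (\sum_(j < k i) (1 - x))).
  have := @one_sub_prod_le R 'I_(k i) (index_enum _) predT (fun=> x) (fun=> cos_max _).
  by rewrite [X in 1 - X]big_const card_ord iter_mulr_1.
rewrite sumr_const card_ord -[_ *+ k i]mulr_natl.
rewrite [leRHS](_ : _ = (k i)%:R * ((theta i * (s - s')) ^+ 2 / 2)); last by field.
by apply: ler_wpM2l => //; exact: one_sub_cos_le.
Qed.

Variables rho s : R -> R.
Let c (y : R) := tensor_map k (sweep w (rho y) (s y)).

(** Divided by (z - y) ^ 2, the chord estimate passes to the limit z = y. *)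
Lemma sweep_speed (y drho ds : R) : smooth_curve c ->
  (\forall z \near y, 0 < rho z) ->
  is_derive y 1 rho drho -> is_derive y 1 s ds ->
  speed alpha c y ^+ 2 <=
    drho ^+ 2 + alpha ^+ 2 * (rho y) ^+ 2 * (Mdist k p q ^+ 2 * ds ^+ 2).
Proof.
move=> cs rho_near drhoP dsP; have r0 := nbhs_singleton rho_near.
rewrite sqr_sqrtr ?warped_metric_ge0//.
have N0 : 0 < tensor_norm (c y) by rewrite tensor_norm_map//; exact: preSV_sweep.
have [W [WE Wc <-]] := chord_form_derivative alpha
  (fun J => is_derive_velocity y J cs) N0.
have [f [fE fc <-]] := (is_derive1_caratheodory _ _ _).1 drhoP.
have [g [gE gc <-]] := (is_derive1_caratheodory _ _ _).1 dsP.
have rc : {for y, continuous rho}.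
  exact: is_derive_continuous drhoP.
pose V z := f z ^+ 2 + alpha ^+ 2 * (rho y * rho z) * (Mdist k p q ^+ 2 * g z ^+ 2).
have f2c : {for y, continuous (fun z => f z ^+ 2)} by apply: continuousM; exact: fc.
have g2c : {for y, continuous (fun z => g z ^+ 2)} by apply: continuousM; exact: gc.
have Vc : {for y, continuous V}.
  apply: continuousD => //; apply: continuousM.
    apply: continuousM; first exact: cst_continuous.
    by apply: continuousM => //; exact: cst_continuous.
  by apply: continuousM => //; exact: cst_continuous.
have -> : f y ^+ 2 + alpha ^+ 2 * rho y ^+ 2 * (Mdist k p q ^+ 2 * g y ^+ 2) = V y.
  by rewrite /V expr2.
apply: (@ler_cvg_to _ (y^')%classic _ _ W V).
- exact: cvg_within_filter Wc.
- exact: cvg_within_filter Vc.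
- have near_z : \forall z \near y^', 0 < rho z by exact: nbhs_dnbhs.
  have ne_z : \forall z \near y^', z != y by exact: nbhs_dnbhs_neq.
  apply: filterS2 near_z ne_z => z rz zy.
  have zy2 : 0 < (z - y) ^+ 2 by rewrite lt_neqAle eq_sym sqrf_eq0 subr_eq0 zy sqr_ge0.
  rewrite -(ler_pM2r zy2) -WE; apply: le_trans (sweep_chord _ _ r0 rz) _.
  rewrite -(opprB (rho z)) -(opprB (s z)) !sqrrN fE gE /V.
  by rewrite le_eqVlt; apply/orP; left; apply/eqP; ring.
Qed.

End Sweep.

(** * Short curves *)

Section UpperBound.
Variables (R : realType) (d : nat) (n k : 'I_d -> nat) (alpha : R).
Hypothesis hn : forall i, (2 <= n i)%N.
Variables (p q : preSV_point R n).
Hypotheses (pp : preSV p) (qq : preSV q).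
Local Notation mu := (@lebesgue_measure R).
Local Notation M := (Mdist k p q).

(** The factors turn at a rate proportional to the derivative of atan.  The
   length is compared with a primitive T of a bound tau for the speed rather
   than computed. *)
Lemma exists_sweep_curve (y0 y1 : R) (rho drho tau T : R -> R) : y0 < y1 ->
  generated (@atan_wave R) rho ->
  (forall y : R, is_derive y 1 rho (drho y)) ->
  (forall y, y0 <= y <= y1 -> 0 < rho y) -> rho y0 = p.1 -> rho y1 = q.1 ->
  (forall y : R, is_derive y 1 T (tau y)) -> continuous tau ->
  (forall y, y0 <= y <= y1 -> 0 <= tau y) ->
  (forall y, y0 <= y <= y1 -> drho y ^+ 2 + alpha ^+ 2 * rho y ^+ 2 *
     (M ^+ 2 * ((1 + y ^+ 2)^-1 / (atan y1 - atan y0)) ^+ 2) <= tau y ^+ 2) ->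
  exists c, connecting_curve (tensor_map k p) (tensor_map k q) y0 y1 c /\
    (curve_length alpha y0 y1 c <= (T y1 - T y0)%:E)%E.
Proof.
move=> y01 rhoG rhoD rho0 rhop rhoq TD tauc tau0 speed_le.
have wex : forall i, exists w : 'rV[R]_(n i), [/\ euclidean_dot w w = 1,
    euclidean_dot (p.2 i) w = 0 &
    q.2 i = cos (sphere_angle (p.2 i) (q.2 i)) *: p.2 i +
            sin (sphere_angle (p.2 i) (q.2 i)) *: w].
  by move=> i; apply: great_circle => //; [exact: pp.2|exact: qq.2].
pose w i := sval (cid (wex i)); have wP i := svalP (cid (wex i)).
have ww i : euclidean_dot (w i) (w i) = 1 by case: (wP i).
have pw i : euclidean_dot (p.2 i) (w i) = 0 by case: (wP i).
have qE i : q.2 i = cos (sphere_angle (p.2 i) (q.2 i)) *: p.2 i +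
            sin (sphere_angle (p.2 i) (q.2 i)) *: w i by case: (wP i).
pose D := atan y1 - atan y0.
have D0 : 0 < D by rewrite subr_gt0 lt_atan.
pose s y := (atan y - atan y0) / D.
have sD (y : R) : is_derive y 1 s ((1 + y ^+ 2)^-1 / D).
  have := is_derive_atan y => ?; apply: is_derive_eq; rewrite /GRing.scale/=; ring.
pose c y := tensor_map k (sweep p q w (rho y) (s y)).
have cs : smooth_curve c.
  move=> J; apply: atan_wave_smooth.
  have -> : (fun y => c y J) = fun y => rho y * \prod_i \prod_(j < k i)
      (cos (sphere_angle (p.2 i) (q.2 i) / D * (atan y + - atan y0)) * p.2 i 0 (J i j) +
       sin (sphere_angle (p.2 i) (q.2 i) / D * (atan y + - atan y0)) * w i 0 (J i j)).
    apply/funext => y; rewrite ffunE; congr (_ * _).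
    apply: eq_bigr => i _; apply: eq_bigr => j _; rewrite !mxE /s.
    by rewrite mulrA mulrAC.
  apply: generated_mul => //; apply: generated_prod => i; apply: generated_prod => j.
  apply: generated_add; apply: generated_mul; try exact: generated_cst.
    exact: generated_cos.
  exact: generated_sin.
have cN y : y0 <= y <= y1 -> 0 < tensor_norm (c y).
  move=> yy; rewrite tensor_norm_map/=; first exact: rho0.
  by apply: preSV_sweep => //; exact: rho0.
exists c; split; last first.
  have <- : (\int[mu]_(y in `[y0, y1]) (tau y)%:E = (T y1 - T y0)%:E)%E.
    have TC y : {for y, continuous T}.
      exact: is_derive_continuous (TD y).
    rewrite EFinB; apply: continuous_FTC2 => //.
    - exact: continuous_subspaceT.
    - split; first by move=> y _; apply: ex_derive.
        by apply: cvg_at_right_filter; exact: TC.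
      by apply: cvg_at_left_filter; exact: TC.
    - by move=> y _; rewrite derive1E derive_val.
  rewrite /curve_length; apply: ge0_le_integral => //=.
  - by apply/measurable_EFinP; exact: smooth_curve_measurable_speed.
  - apply/measurable_EFinP; apply: subspace_continuous_measurable_fun => //.
    exact: continuous_subspaceT.
  - move=> y; rewrite in_itv/= => yy; rewrite lee_fin -/(speed alpha c y).
    rewrite -ler_sqr ?nnegrE ?sqrtr_ge0 ?tau0//.
    apply: le_trans (speed_le y yy).
    apply: sweep_speed => //.
    have rc : {for y, continuous rho}.
      exact: is_derive_continuous (rhoD y).
    exact: cvgr_gt rc _ (rho0 y yy).
split => //.
- exists [:: y1]; first exact: itv_partition1.
  by case=> //= _ J; exists (fun y => c y J).
- move=> y; rewrite in_itv/= => yy.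
  by exists (sweep p q w (rho y) (s y)) => //; apply: preSV_sweep => //; exact: rho0.
- apply/ffunP => J; rewrite !ffunE /= rhop; congr (_ * _).
  apply: eq_bigr => i _; apply: eq_bigr => j _.
  by rewrite /s subrr mul0r mulr0 cos0 sin0 scale1r scale0r addr0.
- apply/ffunP => J; rewrite !ffunE /= rhoq; congr (_ * _).
  apply: eq_bigr => i _; apply: eq_bigr => j _.
  by rewrite /s divff ?gt_eqF// mulr1 -qE.
Qed.

(** Radius kappa sqrt (1 + y ^ 2) against angle atan y is a straight line at
   distance kappa from the apex, parametrized at constant speed kappa; K is the
   factor by which the angle is stretched, and
   sqrt (1 + a) <= 1 + a / 2 bounds the speed. *)
Lemma exists_hyperbolic_curve (kappa y0 y1 : R) : 0 < kappa -> y0 < y1 ->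
  kappa * Num.sqrt (1 + y0 ^+ 2) = p.1 -> kappa * Num.sqrt (1 + y1 ^+ 2) = q.1 ->
  let K := alpha * M / (atan y1 - atan y0) in
  exists c, connecting_curve (tensor_map k p) (tensor_map k q) y0 y1 c /\
    (curve_length alpha y0 y1 c <= (kappa * (y1 - y0) +
       kappa * ((K ^+ 2 - 1) / 2) * (atan y1 - atan y0))%:E)%E.
Proof.
move=> k0 y01 kp kq K; set D := atan y1 - atan y0.
have D0 : 0 < D by rewrite subr_gt0 lt_atan.
pose rho y := kappa * ((1 + y * y) * cos (1 * (atan y + 0))).
pose drho y := kappa * (y * cos (atan y)).
pose tau y := kappa * (1 + (K ^+ 2 - 1) / 2 * (1 + y ^+ 2)^-1).
pose T y := kappa * (y + (K ^+ 2 - 1) / 2 * atan y).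
have y2 (y : R) : 0 < 1 + y ^+ 2 by rewrite ltr_pwDl// sqr_ge0.
have rhoE y : rho y = kappa * Num.sqrt (1 + y ^+ 2).
  rewrite /rho mul1r addr0 cos_atan -expr2; congr (_ * _).
  by rewrite -{1}(sqr_sqrtr (ltW (y2 y))) expr2 mulfK// gt_eqF// sqrtr_gt0.
have K1 (y : R) : -1 <= (K ^+ 2 - 1) * (1 + y ^+ 2)^-1.
  have : (1 + y ^+ 2)^-1 <= 1 by rewrite invf_le1// lerDl sqr_ge0.
  have : 0 < (1 + y ^+ 2)^-1 by rewrite invr_gt0.
  have := sqr_ge0 K; move: (K ^+ 2) (_^-1) => a b *; nra.
have -> : (kappa * (y1 - y0) + kappa * ((K ^+ 2 - 1) / 2) * D) = T y1 - T y0.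
  by rewrite /T /D; ring.
apply: (@exists_sweep_curve y0 y1 rho drho tau T) => //.
- apply: generated_mul; first exact: generated_cst.
  apply: generated_mul; last exact: generated_cos.
  apply: generated_add; first exact: generated_cst.
  by apply: generated_mul; apply: generated_base; left.
- move=> y; have dat := is_derive_atan y; rewrite /rho; apply: is_derive_eq.
  rewrite /GRing.scale/= mul1r addr0 mulr1 sin_atan /drho.
  by field; rewrite gt_eqF.
- by move=> y _; rewrite rhoE mulr_gt0// sqrtr_gt0.
- by rewrite rhoE.
- by rewrite rhoE.
- move=> y; suff : {for y, continuous tau} by [].
  apply: continuousM; first exact: cst_continuous.
  apply: continuousD; first exact: cst_continuous.
  apply: continuousM; first exact: cst_continuous.
  apply: continuousV; first by rewrite gt_eqF.
  by apply: continuousD; [exact: cst_continuous|apply: continuousM; exact: cvg_id].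
- move=> y _; rewrite /tau mulr_ge0 ?(ltW k0)//.
  by have := K1 y; rewrite mulrAC; lra.
- move=> y _; rewrite rhoE /drho /tau.
  set x := (1 + y ^+ 2)^-1.
  have x1 : x * (1 + y ^+ 2) = 1 by rewrite mulVf// gt_eqF.
  have -> : (kappa * Num.sqrt (1 + y ^+ 2)) ^+ 2 = kappa ^+ 2 * (1 + y ^+ 2).
    by rewrite exprMn sqr_sqrtr// ltW.
  have -> : (kappa * (y * cos (atan y))) ^+ 2 = kappa ^+ 2 * (1 - x).
    by rewrite !exprMn cos_atan_sqr -/x -[X in X - x]x1; ring.
  have -> : alpha ^+ 2 * (kappa ^+ 2 * (1 + y ^+ 2)) * (M ^+ 2 * (x / D) ^+ 2) =
      kappa ^+ 2 * (K ^+ 2 * x).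
    transitivity (kappa ^+ 2 * (K ^+ 2 * x) * (x * (1 + y ^+ 2)));
      last by rewrite x1 mulr1.
    by rewrite /K -/D; field; rewrite gt_eqF.
  rewrite -mulrDr [leRHS]exprMn; apply: ler_wpM2l; first exact: sqr_ge0.
  by have := sqr_ge0 ((K ^+ 2 - 1) / 2 * x); nra.
Qed.

(** Factors at distance 0 do not turn, and only the radius varies. *)
Lemma exists_radial_curve : M = 0 ->
  exists c, connecting_curve (tensor_map k p) (tensor_map k q) 0 1 c /\
    (curve_length alpha 0 1 c <= `|q.1 - p.1|%:E)%E.
Proof.
move=> M0; pose rho y := p.1 + (q.1 - p.1) * y.
have [[p0 _] [q0 _]] := (pp, qq).
have -> : `|q.1 - p.1| = `|q.1 - p.1| * 1 - `|q.1 - p.1| * 0 by rewrite mulr0 mulr1 subr0.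
apply: (@exists_sweep_curve 0 1 rho (fun=> q.1 - p.1) (fun=> `|q.1 - p.1|)
  (fun y => `|q.1 - p.1| * y)) => //.
- apply: generated_add; first exact: generated_cst.
  apply: generated_mul; first exact: generated_cst.
  by apply: generated_base; left.
- by move=> y; rewrite ?/rho; apply: is_derive_eq; rewrite /GRing.scale/=; ring.
- by move=> y /andP[y0 y1]; rewrite /rho; nra.
- by rewrite /rho mulr0 addr0.
- by rewrite /rho mulr1 addrC subrK.
- by move=> y; rewrite ?/rho; apply: is_derive_eq; rewrite /GRing.scale/=; ring.
- exact: cst_continuous.
- by move=> y _; rewrite M0 expr0n mul0r mulr0 addr0 real_normK ?num_real.
Qed.

End UpperBound.
Section PlaneTriangle.
Variables (R : realType) (lambda mu beta : R).
Hypotheses (lambda0 : 0 < lambda) (mu0 : 0 < mu).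

(** The law of cosines. *)
Definition opposite_side : R :=
  Num.sqrt (lambda ^+ 2 + mu ^+ 2 - 2 * lambda * mu * cos beta).

Lemma opposite_side_sqr :
  opposite_side ^+ 2 = lambda ^+ 2 + mu ^+ 2 - 2 * lambda * mu * cos beta.
Proof.
rewrite sqr_sqrtr//; have := cos_le1 beta; have := mulr_gt0 lambda0 mu0.
have := sqr_ge0 (lambda - mu); nra.
Qed.

Hypothesis beta_itv : 0 < beta < pi.

Let sb : 0 < sin beta. Proof. exact: sin_gt0_pi. Qed.

Lemma opposite_side_gt0 : 0 < opposite_side.
Proof.
rewrite sqrtr_gt0.
have -> : lambda ^+ 2 + mu ^+ 2 - 2 * lambda * mu * cos beta =
    (lambda - mu * cos beta) ^+ 2 + mu ^+ 2 * (1 - cos beta ^+ 2) by ring.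
by rewrite -sin2cos2 ltr_wpDl ?sqr_ge0// mulr_gt0 ?exprn_gt0.
Qed.

Let D := opposite_side.
Let D0 : 0 < D := opposite_side_gt0.

(** The foot of the perpendicular from the apex to the opposite side is the
   origin of the parameter y, and kappa is the length of that perpendicular. *)
Lemma opposite_side_parametrization : exists kappa y0 y1 : R,
  [/\ 0 < kappa, atan y1 - atan y0 = beta, kappa * Num.sqrt (1 + y0 ^+ 2) = lambda,
      kappa * Num.sqrt (1 + y1 ^+ 2) = mu & kappa * (y1 - y0) = opposite_side].
Proof.
have DD := opposite_side_sqr; rewrite -/D in DD.
have cs := cos2Dsin2 beta.
pose C := cos beta; pose S := sin beta; rewrite -/C -/S in DD cs.
have S0 : 0 < S by exact: sb.
have S2 : S ^+ 2 = 1 - C ^+ 2 by rewrite -cs; ring.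
pose y0 := (mu * C - lambda) / (mu * S); pose y1 := (mu - lambda * C) / (lambda * S).
have sqrtE (N x : R) : 0 < N -> 1 + x ^+ 2 = (D / (N * S)) ^+ 2 ->
    Num.sqrt (1 + x ^+ 2) = D / (N * S).
  by move=> N0 ->; rewrite sqrtr_sqr ger0_norm// divr_ge0 ?mulr_ge0 ?ltW.
have r0 : Num.sqrt (1 + y0 ^+ 2) = D / (mu * S).
  apply: sqrtE => //; rewrite [RHS]expr_div_n DD /y0.
  transitivity ((mu ^+ 2 * S ^+ 2 + (mu * C - lambda) ^+ 2) / (mu * S) ^+ 2).
    by field; rewrite !gt_eqF.
  by congr (_ / _); rewrite S2; ring.
have r1 : Num.sqrt (1 + y1 ^+ 2) = D / (lambda * S).
  apply: sqrtE => //; rewrite [RHS]expr_div_n DD /y1.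
  transitivity ((lambda ^+ 2 * S ^+ 2 + (mu - lambda * C) ^+ 2) / (lambda * S) ^+ 2).
    by field; rewrite !gt_eqF.
  by congr (_ / _); rewrite S2; ring.
exists (lambda * mu * S / D), y0, y1; split.
- by rewrite divr_gt0// !mulr_gt0.
- have ca : cos (atan y0) = mu * S / D by rewrite cos_atan r0 invf_div.
  have sa : sin (atan y0) = (mu * C - lambda) / D.
    by rewrite sin_atan ca /y0; field; rewrite !gt_eqF.
  have cab : cos (atan y0 + beta) = lambda * S / D.
    by rewrite cosD ca sa -/C -/S; field; rewrite gt_eqF.
  have sab : sin (atan y0 + beta) = (mu - lambda * C) / D.
    rewrite sinD ca sa -/C -/S.
    transitivity ((mu * (C ^+ 2 + S ^+ 2) - lambda * C) / D); last by rewrite cs mulr1.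
    by field; rewrite gt_eqF.
  have y1E : y1 = tan (atan y0 + beta).
    by rewrite /tan cab sab /y1; field; rewrite !gt_eqF.
  have cab0 : 0 < cos (atan y0 + beta) by rewrite cab divr_gt0// mulr_gt0.
  have /andP[b0 bpi] := beta_itv.
  have a1 := atan_gtNpi2 y0; have a2 := atan_ltpi2 y0.
  suff -> : atan y1 = atan y0 + beta by rewrite addrC addKr.
  rewrite y1E; apply: tanK; rewrite in_itv/=; apply/andP; split; first by lra.
  (* the sum lies in ]-pi/2, 3pi/2[, where a positive cosine means < pi/2 *)
  rewrite ltNge; apply/negP => ge.
  have : 0 <= cos (atan y0 + beta - pi).
    by apply: cos_ge0_pihalf; apply/andP; split; lra.
  rewrite cosB cospi sinpi; lra.
- by rewrite r0; field; rewrite !gt_eqF.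
- by rewrite r1; field; rewrite !gt_eqF.
- apply: (mulIf (lt0r_neq0 D0)); rewrite -expr2 -/D DD /y0 /y1.
  transitivity (lambda ^+ 2 * (S ^+ 2 + C ^+ 2) * 0 +
    (mu * (mu - lambda * C) - lambda * (mu * C - lambda))); last by ring.
  by field; rewrite !gt_eqF.
Qed.

(** The direction of the opposite side realizes its length as a difference of
   coordinates, which is the form in which lengths are bounded below. *)
Lemma opposite_side_direction : exists e1 e2 : R, e1 ^+ 2 + e2 ^+ 2 = 1 /\
  mu * (e1 * cos beta + e2 * sin beta) - lambda * e1 = opposite_side.
Proof.
have DD := opposite_side_sqr; rewrite -/D in DD.
have cs := cos2Dsin2 beta.
exists ((mu * cos beta - lambda) / D), (mu * sin beta / D); split.
  apply: (mulIf (lt0r_neq0 (exprn_gt0 2 D0))); rewrite mul1r [RHS]DD.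
  transitivity (mu ^+ 2 * (cos beta ^+ 2 + sin beta ^+ 2) + lambda ^+ 2
    - 2 * lambda * mu * cos beta); last by rewrite cs; ring.
  by field; rewrite gt_eqF.
apply: (mulIf (lt0r_neq0 D0)); rewrite -expr2 -/D DD.
transitivity (mu ^+ 2 * (cos beta ^+ 2 + sin beta ^+ 2) + lambda ^+ 2
    - 2 * lambda * mu * cos beta); last by rewrite cs; ring.
by field; rewrite gt_eqF.
Qed.

End PlaneTriangle.

Section Curves.
Variables (R : realType) (d : nat) (n k : 'I_d -> nat) (alpha : R).
Hypothesis hn : forall i, (2 <= n i)%N.
Hypothesis alpha0 : 0 < alpha.
Variables (p q : preSV_point R n).
Hypotheses (pp : preSV p) (qq : preSV q).
Local Notation M := (Mdist k p q).

Lemma exists_straight_curve : 0 < M -> alpha * M < pi ->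
  exists a b c, connecting_curve (tensor_map k p) (tensor_map k q) a b c /\
    (curve_length alpha a b c <= (opposite_side p.1 q.1 (alpha * M))%:E)%E.
Proof.
move=> M0 Mpi; have b0 : 0 < alpha * M by exact: mulr_gt0.
have bitv : 0 < alpha * M < pi by rewrite b0.
have [kappa [y0 [y1 [k0 yb yp yq len]]]] :=
  opposite_side_parametrization pp.1 qq.1 bitv.
have y01 : y0 < y1.
  by rewrite ltNge; apply/negP => /le_atan; have := b0; rewrite -yb; lra.
have [c [cPQ cL]] := exists_hyperbolic_curve k alpha hn pp qq k0 y01 yp yq.
exists y0, y1, c; split => //; apply: (le_trans cL).
by rewrite lee_fin yb divff ?gt_eqF// expr1n subrr mul0r mulr0 mul0r addr0 len.
Qed.

(** For kappa tending to 0 the curve of [exists_hyperbolic_curve] approaches the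
   broken line through the apex: its angular part has length of order kappa,
   since the parameter interval contains [-1, 1] and the angle atan y turns by
   more than 1. *)
Lemma exists_curve_near_apex (e : R) : 0 < e ->
  exists a b c, connecting_curve (tensor_map k p) (tensor_map k q) a b c /\
    (curve_length alpha a b c <= (p.1 + q.1 + e)%:E)%E.
Proof.
move=> e0; have [[p0 _] [q0 _]] := (pp, qq).
pose X := (alpha * M) ^+ 2 + 1.
have X0 : 0 < X by rewrite ltr_wpDl// sqr_ge0.
pose kappa := Num.min (Num.min (p.1 / 2) (q.1 / 2)) (e / X).
have k0 : 0 < kappa by rewrite !lt_min !divr_gt0.
have [kp kq ke] : [/\ kappa <= p.1 / 2, kappa <= q.1 / 2 & kappa <= e / X].
  by split; rewrite !ge_min lexx ?orbT.
pose y (l : R) := Num.sqrt ((l / kappa) ^+ 2 - 1).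
have yP l : kappa <= l / 2 -> [/\ 1 <= y l, kappa * y l <= l &
    kappa * Num.sqrt (1 + y l ^+ 2) = l].
  move=> kl; have l2 : 2 <= l / kappa by rewrite ler_pdivlMr//; lra.
  have pos : 1 <= (l / kappa) ^+ 2 - 1 by nra.
  have y2 : y l ^+ 2 = (l / kappa) ^+ 2 - 1 by rewrite sqr_sqrtr//; lra.
  have y0 : 0 <= y l by exact: sqrtr_ge0.
  have ky : kappa * (l / kappa) = l by field; rewrite gt_eqF.
  split; first by rewrite -(sqrtr1 R) ler_wsqrtr.
    rewrite -{2}ky ler_wpM2l ?(ltW k0)// -ler_sqr ?nnegrE ?y0 ?y2 ?gerBl//.
    by apply: le_trans l2.
  rewrite y2 addrC subrK sqrtr_sqr ger0_norm//.
  by apply: le_trans l2.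
have [p1 pk pE] := yP _ kp; have [q1 qk qE] := yP _ kq.
have y01 : - y p.1 < y q.1 by lra.
have pE' : kappa * Num.sqrt (1 + (- y p.1) ^+ 2) = p.1 by rewrite sqrrN.
have [c [cPQ cL]] := exists_hyperbolic_curve k alpha hn pp qq k0 y01 pE' qE.
exists (- y p.1), (y q.1), c; split => //; apply: (le_trans cL).
rewrite lee_fin atanN !opprK; set D := atan _ + atan _.
have D1 : 1 <= D.
  have h1 : pi / 4 <= atan (y p.1) by rewrite -atan1; exact: le_atan.
  have h2 : pi / 4 <= atan (y q.1) by rewrite -atan1; exact: le_atan.
  by have := pi_ge2 R; rewrite /D; lra.
have -> : kappa * (((alpha * M / D) ^+ 2 - 1) / 2) * D =
    kappa * ((alpha * M) ^+ 2 / D) / 2 - kappa * D / 2.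
  by field; rewrite gt_eqF//; lra.
have h : kappa * ((alpha * M) ^+ 2 / D) <= e.
  apply: (@le_trans _ _ (kappa * X)); last by rewrite -ler_pdivlMr.
  rewrite ler_wpM2l ?(ltW k0)// ler_pdivrMr; last by lra.
  have := sqr_ge0 (alpha * M); rewrite /X => ?; nra.
have := mulr_gt0 k0 (lt_le_trans ltr01 D1); lra.
Qed.

End Curves.

(** * Minimizing geodesics *)

Theorem proposition4p11 (R : realType) (d : nat) (hd : (1 <= d)%N)
    (n k : 'I_d -> nat)
    (hn : forall i, (2 <= n i)%N) (hk : forall i, (1 <= k i)%N)
    (alpha : R) (halpha : 0 < alpha)
    (P Q : tensor R n k)
    (hP : segre_veronese P) (hQ : segre_veronese Q) :
  (exists (a b : R) (c : R -> tensor R n k),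
     minimizing_geodesic alpha P Q a b c) <->
  (exists p q : preSV_point R n,
     matched P Q p q /\ compatible k alpha p q).
Proof.
have dist_le (x : R) a b c : connecting_curve P Q a b c ->
    (curve_length alpha a b c <= x%:E)%E -> (intrinsic_distance alpha P Q <= x%:E)%E.
  by move=> cPQ; apply: le_trans; apply: ereal_inf_lbound; exists a, b, c.
split=> [[a [b [c [cPQ cmin]]]]|[p [q [pq_matched pq_compat]]]].
  have [p [q pq_matched]] := exists_matched hk hP hQ; exists p, q; split => //.
  have [pP qQ min_pq] := pq_matched.
  rewrite /compatible ltNge; apply/negP; rewrite ler_pdivrMr// mulrC => Mpi.
  have pi_le q' : representatives Q q' -> pi <= alpha * Mdist k p q'.
    by move=> q'Q; apply: (le_trans Mpi); rewrite ler_wpM2l ?(ltW halpha)// min_pq.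
  have := curve_length_gt hn hk halpha pP (pi_ge0 R) pi_le cPQ erefl.
  rewrite cmin ltNge => /negP; apply; apply/lee_addgt0Pr => e e0.
  have [[pp pE] [qq qE]] := (pP, qQ).
  have [a' [b' [c' [c'PQ]]]] := exists_curve_near_apex k alpha hn pp qq e0.
  rewrite -(tensor_norm_map k pp) -(tensor_norm_map k qq) pE qE in c'PQ *.
  exact: dist_le.
have [pP qQ min_pq] := pq_matched.
have [[pp pE] [qq qE]] := (pP, qQ).
pose beta := alpha * Mdist k p q.
have beta0 : 0 <= beta by rewrite mulr_ge0 ?Mdist_ge0 ?ltW.
have beta_pi : beta < pi by rewrite /beta mulrC -ltr_pdivlMr.
have beta_le q' : representatives Q q' -> beta <= alpha * Mdist k p q'.
  by move=> q'Q; rewrite ler_wpM2l ?(ltW halpha)// min_pq.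
have nP : tensor_norm P = p.1 by rewrite -pE tensor_norm_map.
have nQ : tensor_norm Q = q.1 by rewrite -qE tensor_norm_map.
suff [x [lower [a [b [c [cPQ cL]]]]]] : exists x : R,
    (forall a b c, connecting_curve P Q a b c -> (x%:E <= curve_length alpha a b c)%E) /\
    exists a b c, connecting_curve P Q a b c /\ (curve_length alpha a b c <= x%:E)%E.
  exists a, b, c; split => //; apply/le_anti/andP; split; last first.
    by apply: ereal_inf_lbound; exists a, b, c.
  apply: (le_trans cL); apply: le_ereal_inf_tmp => _ [a' [b' [c' [c'PQ ->]]]].
  exact: lower.
have [M0|M0] := eqVneq (Mdist k p q) 0.
  exists `|q.1 - p.1|; split=> [a b c cPQ|].
    have e10 : (1 : R) ^+ 2 + 0 ^+ 2 = 1 by rewrite expr1n expr0n addr0.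
    have := curve_length_ge hn hk halpha pP beta0 beta_le cPQ e10.
    by rewrite /beta M0 mulr0 cos0 mul0r addr0 !mulr1 nP nQ.
  have [c cP] := exists_radial_curve alpha hn pp qq M0.
  by exists 0, 1, c; rewrite pE qE in cP.
have Mgt0 : 0 < Mdist k p q by rewrite lt_neqAle eq_sym M0 Mdist_ge0.
have beta_itv : 0 < beta < pi by rewrite beta_pi mulr_gt0.
exists (opposite_side p.1 q.1 beta); split=> [a b c cPQ|].
  have [e1 [e2 [e12 <-]]] := opposite_side_direction pp.1 qq.1 beta_itv.
  apply: le_trans (curve_length_ge hn hk halpha pP beta0 beta_le cPQ e12).
  by rewrite nP nQ lee_fin ler_norm.
have [a [b [c cP]]] := exists_straight_curve hn halpha pp qq Mgt0 beta_pi.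
by exists a, b, c; rewrite pE qE in cP.
Qed.
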